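(* Let $A$ be a unital C*-algebra and let $\{x_j : j\in\mathbb J\}$ be a standard frame of a finitely or countably generated Hilbert $A$-module $\mathcal H$. Then $\{x_j\}$ is the image of a standard normalized tight frame $\{y_j : j\in\mathbb J\}$ of $\mathcal H$ under an invertible adjointable bounded $A$-linear operator $T$ on $\mathcal H$; $T$ can be chosen positive and equal to $(\theta^*\theta)^{1/2}$, where $\theta$ is the frame transform of $\{x_j\}$. Conversely, the image of a standard normalized tight frame of $\mathcal H$ under an invertible adjointable bounded $A$-linear operator on $\mathcal H$ is a standard frame of $\mathcal H$. Moreover, every standard frame $\{x_j\}$ is a set of generators of $\mathcal H$ as a Hilbert $A$-module (its $A$-linear span is norm-dense).
   Context: A (left) Hilbert $A$-module is a left $A$-module $\mathcal H$ with an $A$-valued inner product $\langle\cdot,\cdot\rangle$, $A$-linear in the first argument, with $\langle x,y\rangle=\langle y,x\rangle^*$, $\langle x,x\rangle\ge0$ and $=0$ only for $x=0$, complete in $\|x\|=\|\langle x,x\rangle\|^{1/2}$. Finitely generated: every element is an $A$-linear combination of finitely many fixed elements; countably generated: some countable subset has norm-dense $A$-linear span. $l_2(A)$ is the Hilbert $A$-module of sequences $(a_j)$ in $A$ with $\sum_ja_ja_j^*$ norm-convergent, inner product $\sum_ja_jb_j^*$. A sequence $\{x_j:j\in\mathbb J\}$ ($\mathbb J$ finite or countable) is a frame if there are $C,D>0$ with $C\langle x,x\rangle\le\sum_j\langle x,x_j\rangle\langle x_j,x\rangle\le D\langle x,x\rangle$ for all $x$; normalized tight if $C=D=1$ works;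 standard if this series converges in norm for all $x$. The frame transform of a standard frame is $\theta:\mathcal H\to l_2(A)$, $\theta(x)=\{\langle x,x_j\rangle\}_{j}$ (it is adjointable). *)

(* Defs.v *)
From HB Require Import structures.
From mathcomp Require Import all_boot all_order all_algebra.
From mathcomp Require Import reals.
From mathcomp.real_closed Require Import complex.

Set Implicit Arguments.
Unset Strict Implicit.
Unset Printing Implicit Defensive.

Import Order.TTheory GRing.Theory Num.Theory.
Local Open Scope ring_scope.

Definition cvg_wrt (R : realType) (V : zmodType) (N : V -> R)
    (u : nat -> V) (l : V) : Prop :=
  forall eps : R, 0 < eps -> exists n0 : nat,
    forall n : nat, (n0 <= n)%N -> N (u n - l) < eps.

Definition cauchy_wrt (R : realType) (V : zmodType) (N : V -> R)
    (u : nat -> V) : Prop :=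
  forall eps : R, 0 < eps -> exists n0 : nat,
    forall n m : nat, (n0 <= n)%N -> (n0 <= m)%N -> N (u n - u m) < eps.

Record cstar (R : realType) (A : algType R[i]) := CStar {
  cs_star : A -> A;
  cs_norm : A -> R;
  cs_star_add : forall a b : A, cs_star (a + b) = cs_star a + cs_star b;
  cs_star_scale : forall (c : R[i]) (a : A), cs_star (c *: a) = conjc c *: cs_star a;
  cs_star_mul : forall a b : A, cs_star (a * b) = cs_star b * cs_star a;
  cs_star_invol : forall a : A, cs_star (cs_star a) = a;
  cs_norm_ge0 : forall a : A, 0 <= cs_norm a;
  cs_norm_eq0 : forall a : A, cs_norm a = 0 -> a = 0;
  cs_norm_scale : forall (c : R[i]) (a : A),
      cs_norm (c *: a) = ComplexField.Normc.normc c * cs_norm a;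
  cs_norm_triangle : forall a b : A, cs_norm (a + b) <= cs_norm a + cs_norm b;
  cs_norm_submul : forall a b : A, cs_norm (a * b) <= cs_norm a * cs_norm b;
  cs_norm_cstar : forall a : A, cs_norm (cs_star a * a) = cs_norm a ^+ 2;
  cs_complete : forall u : nat -> A, cauchy_wrt cs_norm u ->
      exists l : A, cvg_wrt cs_norm u l
}.

Definition cs_pos (R : realType) (A : algType R[i]) (CA : cstar A) (a : A) : Prop :=
  exists b : A, a = cs_star CA b * b.

Definition cs_le (R : realType) (A : algType R[i]) (CA : cstar A) (a b : A) : Prop :=
  cs_pos CA (b - a).

Record hilbert_module (R : realType) (A : algType R[i]) (CA : cstar A)
    (H : lmodType A) := HModule {
  hm_ip : H -> H -> A;
  hm_ip_linl : forall (a : A) (x y z : H),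
      hm_ip (a *: x + y) z = a * hm_ip x z + hm_ip y z;
  hm_ip_sym : forall x y : H, hm_ip x y = cs_star CA (hm_ip y x);
  hm_ip_pos : forall x : H, cs_pos CA (hm_ip x x);
  hm_ip_def : forall x : H, hm_ip x x = 0 -> x = 0;
  hm_complete : forall u : nat -> H,
      cauchy_wrt (fun x => Num.sqrt (cs_norm CA (hm_ip x x))) u ->
      exists l : H, cvg_wrt (fun x => Num.sqrt (cs_norm CA (hm_ip x x))) u l
}.

Definition hnorm (R : realType) (A : algType R[i]) (CA : cstar A) (H : lmodType A)
    (HM : hilbert_module CA H) (x : H) : R :=
  Num.sqrt (cs_norm CA (hm_ip HM x x)).

(* Index sets: J = None is the countable index set nat,               *)
(* J = Some n is the finite index set {0, ..., n-1}.                   *)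

Definition inJ (J : option nat) (j : nat) : bool :=
  match J with None => true | Some n => (j < n)%N end.

Definition psum (V : zmodType) (J : option nat) (f : nat -> V) (n : nat) : V :=
  \sum_(j < n | inJ J j) f j.

Definition series_to (R : realType) (A : algType R[i]) (CA : cstar A)
    (J : option nat) (f : nat -> A) (s : A) : Prop :=
  cvg_wrt (cs_norm CA) (psum J f) s.

Definition standard_frame (R : realType) (A : algType R[i]) (CA : cstar A)
    (H : lmodType A) (HM : hilbert_module CA H) (J : option nat)
    (x : nat -> H) : Prop :=
  exists Cc Dc : R, 0 < Cc /\ 0 < Dc /\
    forall y : H, exists s : A,
      series_to CA J (fun j => hm_ip HM y (x j) * hm_ip HM (x j) y) s /\
      cs_le CA (Complex Cc 0 *: hm_ip HM y y) s /\
      cs_le CA s (Complex Dc 0 *: hm_ip HM y y).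

Definition standard_nt_frame (R : realType) (A : algType R[i]) (CA : cstar A)
    (H : lmodType A) (HM : hilbert_module CA H) (J : option nat)
    (x : nat -> H) : Prop :=
  forall y : H, exists s : A,
    series_to CA J (fun j => hm_ip HM y (x j) * hm_ip HM (x j) y) s /\
    cs_le CA (hm_ip HM y y) s /\
    cs_le CA s (hm_ip HM y y).

Definition in_l2 (R : realType) (A : algType R[i]) (CA : cstar A)
    (J : option nat) (a : nat -> A) : Prop :=
  exists s : A, series_to CA J (fun j => a j * cs_star CA (a j)) s.

Definition frame_transform (R : realType) (A : algType R[i]) (CA : cstar A)
    (H : lmodType A) (HM : hilbert_module CA H) (x : nat -> H) (y : H) : nat -> A :=
  fun j => hm_ip HM y (x j).

(* th' : l_2(A) -> H is the adjoint of theta:                          *)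
(*   <theta y, a>_{l_2} = sum_j <y,x_j> a_j^* = <y, th' a>  for a in l_2 *)
Definition is_transform_adjoint (R : realType) (A : algType R[i]) (CA : cstar A)
    (H : lmodType A) (HM : hilbert_module CA H) (J : option nat)
    (x : nat -> H) (th' : (nat -> A) -> H) : Prop :=
  forall (y : H) (a : nat -> A), in_l2 CA J a ->
    series_to CA J (fun j => frame_transform HM x y j * cs_star CA (a j))
      (hm_ip HM y (th' a)).

Definition is_adjoint (R : realType) (A : algType R[i]) (CA : cstar A)
    (H : lmodType A) (HM : hilbert_module CA H) (T T' : H -> H) : Prop :=
  forall x y : H, hm_ip HM (T x) y = hm_ip HM x (T' y).

Definition is_operator (R : realType) (A : algType R[i]) (CA : cstar A)
    (H : lmodType A) (HM : hilbert_module CA H) (T : H -> H) : Prop :=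
  [/\ (forall x y : H, T (x + y) = T x + T y),
      (forall (a : A) (x : H), T (a *: x) = a *: T x),
      (exists K : R, forall x : H, hnorm HM (T x) <= K * hnorm HM x) &
      (exists T' : H -> H, is_adjoint HM T T')].

Definition op_invertible (R : realType) (A : algType R[i]) (CA : cstar A)
    (H : lmodType A) (HM : hilbert_module CA H) (T : H -> H) : Prop :=
  exists Ti : H -> H, [/\ is_operator HM Ti, cancel T Ti & cancel Ti T].

Definition op_positive (R : realType) (A : algType R[i]) (CA : cstar A)
    (H : lmodType A) (HM : hilbert_module CA H) (T : H -> H) : Prop :=
  exists U U' : H -> H,
    [/\ is_operator HM U, is_adjoint HM U U' & forall x : H, T x = U' (U x)].

Definition spans_dense (R : realType) (A : algType R[i]) (CA : cstar A)
    (H : lmodType A) (HM : hilbert_module CA H) (J : option nat)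
    (x : nat -> H) : Prop :=
  forall (y : H) (eps : R), 0 < eps ->
    exists (n : nat) (c : nat -> A),
      hnorm HM (y - \sum_(j < n | inJ J j) c j *: x j) < eps.

(* countably generated (covers finitely generated): some countable      *)
(* family has norm-dense A-linear span                                  *)
Definition countably_generated (R : realType) (A : algType R[i]) (CA : cstar A)
    (H : lmodType A) (HM : hilbert_module CA H) : Prop :=
  exists g : nat -> H, spans_dense HM None g.

(* Main.v *)
Require Import Defs.
From HB Require Import structures.
From mathcomp Require Import all_boot all_order all_algebra.
From mathcomp Require Import reals boolp.
From mathcomp.real_closed Require Import complex.
From mathcomp Require Import ring lra.

(* The heart of the matter is the positive cone of [A].  If [|t - h| <= t], then
   [h] has a square root, because the power series of [sqrt (1 - z)] converges
   on the closed unit disc; this yields that such elements form a closed convex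
   cone on which the norm is monotone, and Kaplansky's argument identifies it with the
   elements [b^* b].  Summing [a_j x_j] over [a] in [l_2(A)] is then legitimate by
   Cauchy-Schwarz, and [S = theta^* theta] satisfies [C <y,y> <= <S y, y> <= D <y,y>].
   Hence [1 - S / (C + D)] has norm at most [D / (C + D) < 1], so the same power
   series gives a positive invertible [T] with [T^2 = S], and [y_j = T^-1 x_j] is
   normalized tight: [sum_j <y,y_j><y_j,y> = <S T^-1 y, T^-1 y> = <y,y>].  The
   converse follows from [<T y, T y> <= |T|^2 <y,y>], obtained by writing
   [1 - T^* T / |T|^2] as a square, and density from [y = S (S^-1 y)]. *)

Import Order.TTheory GRing.Theory Num.Theory.
Local Open Scope ring_scope.
Set Implicit Arguments.
Unset Strict Implicit.
Unset Printing Implicit Defensive.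

(** * Deciding identities in abelian groups by reflection *)

Inductive zexp := ZVar of nat | ZZero | ZAdd of zexp & zexp | ZOpp of zexp.

Fixpoint zeval (V : zmodType) (env : seq V) (e : zexp) : V :=
  match e with
  | ZVar i => env`_i
  | ZZero => 0
  | ZAdd e1 e2 => zeval env e1 + zeval env e2
  | ZOpp e1 => - zeval env e1
  end.

Fixpoint zcoef (e : zexp) (i : nat) : int :=
  match e with
  | ZVar j => (i == j)%:Z
  | ZZero => 0
  | ZAdd e1 e2 => zcoef e1 i + zcoef e2 i
  | ZOpp e1 => - zcoef e1 i
  end.

Lemma zevalE (V : zmodType) (env : seq V) (e : zexp) :
  zeval env e = \sum_(i < size env) env`_i *~ zcoef e i.
Proof.
elim: e => [j||e1 IH1 e2 IH2|e1 IH1] /=.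
- case: (ltnP j (size env)) => Hj.
    rewrite (bigD1 (Ordinal Hj)) //= eqxx mulr1z big1 ?addr0 // => i.
    by rewrite -val_eqE /= => /negbTE ->.
  by rewrite nth_default // big1 // => i _; rewrite (ltn_eqF (leq_trans _ Hj)).
- by rewrite big1.
- by rewrite IH1 IH2 -big_split /=; apply: eq_bigr => i _; rewrite mulrzDr.
- by rewrite IH1 -sumrN; apply: eq_bigr => i _; rewrite mulrNz.
Qed.

(** By [zevalE] an expression depends only on the integer coefficients of its atoms. Comparing these
    is a closed computation, so [zmod] discharges the hypothesis by [erefl]. *)
Lemma zeval_eq (V : zmodType) (env : seq V) (e1 e2 : zexp) :
  all (fun i => zcoef e1 i == zcoef e2 i) (iota 0 (size env)) ->
  zeval env e1 = zeval env e2.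
Proof.
move=> /allP H; rewrite !zevalE; apply: eq_bigr => i _.
by rewrite (eqP (H i _)) // mem_iota add0n ltn_ord.
Qed.

(* Atoms are compared up to unification: products that look alike may carry
   different structure instances. *)
Ltac zindex x env :=
  match env with
  | ?y :: _ => let _ := match constr:(tt) with _ => unify x y end in constr:(0%N)
  | _ :: ?env' => let n := zindex x env' in constr:(S n)
  end.

Ltac zin x env :=
  match env with
  | ?y :: _ => let _ := match constr:(tt) with _ => unify x y end in constr:(true)
  | _ :: ?env' => zin x env'
  | _ => constr:(false)
  end.

Ltac zatoms t env :=
  lazymatch t with
  | ?a + ?b => let env1 := zatoms a env in zatoms b env1
  | - ?a => zatoms a env
  | 0 => constr:(env)
  | _ => lazymatch zin t env with
         | true => constr:(env)
         | false => constr:(t :: env)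
         end
  end.

Ltac zreify t env :=
  lazymatch t with
  | ?a + ?b => let r := zreify a env in let s := zreify b env in
               constr:(ZAdd r s)
  | - ?a => let r := zreify a env in constr:(ZOpp r)
  | 0 => constr:(ZZero)
  | _ => let n := zindex t env in constr:(ZVar n)
  end.

Ltac zmod :=
  rewrite ?mulr2n;
  lazymatch goal with
  | |- @eq ?V ?x ?y =>
    let e0 := zatoms x (@nil V) in
    let env := zatoms y e0 in
    let r := zreify x env in
    let s := zreify y env in
    exact: (@zeval_eq _ env r s erefl)
  end.

(** * Additive maps, group norms and limits *)

Definition additive_fun (V W : zmodType) (F : V -> W) : Prop :=
  forall x y : V, F (x + y) = F x + F y.

Section AdditiveFun.
Variables (V W : zmodType) (F : V -> W).
Hypothesis FD : additive_fun F.

Lemma additive_fun0 : F 0 = 0.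
Proof. by apply: (addrI (F 0)); rewrite -FD !addr0. Qed.

Lemma additive_funN (x : V) : F (- x) = - F x.
Proof. by apply: (addrI (F x)); rewrite -FD !subrr additive_fun0. Qed.

Lemma additive_funB (x y : V) : F (x - y) = F x - F y.
Proof. by rewrite FD additive_funN. Qed.

End AdditiveFun.

(** These properties are shared by the norm of [A] and the norm of the module; leaving scalars out
    lets one theory of limits serve both. *)
Definition group_norm (R : realType) (V : zmodType) (N : V -> R) : Prop :=
  [/\ N 0 = 0, forall x : V, N (- x) = N x,
      forall x y : V, N (x + y) <= N x + N y & forall x : V, N x = 0 -> x = 0].

Section GroupNorm.
Variables (R : realType) (V : zmodType) (N : V -> R).
Hypothesis hN : group_norm N.

Lemma gnorm0 : N 0 = 0. Proof. by case: hN. Qed.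
Lemma gnormN (x : V) : N (- x) = N x. Proof. by case: hN. Qed.
Lemma gnormD (x y : V) : N (x + y) <= N x + N y. Proof. by case: hN. Qed.
Lemma gnorm_eq0 (x : V) : N x = 0 -> x = 0. Proof. by case: hN => _ _ _; apply. Qed.

Lemma gnorm_ge0 (x : V) : 0 <= N x.
Proof. by have := gnormD x (- x); rewrite subrr gnorm0 gnormN -mulr2n pmulrn_lge0. Qed.

Lemma gnormBC (x y : V) : N (x - y) = N (y - x).
Proof. by rewrite -gnormN opprB. Qed.

Lemma gnorm_sub_trans (y x z : V) : N (x - z) <= N (x - y) + N (y - z).
Proof. by rewrite -[x - z](subrKA y); apply: gnormD. Qed.

Lemma gnorm_le0 (x : V) : (forall eps, 0 < eps -> N x <= eps) -> x = 0.
Proof.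
move=> H; apply: gnorm_eq0; apply/eqP; rewrite eq_le gnorm_ge0 andbT.
by apply/ler_addgt0Pr => e /H; rewrite add0r.
Qed.

Lemma cvg_unique (u : nat -> V) (l l' : V) :
  cvg_wrt N u l -> cvg_wrt N u l' -> l = l'.
Proof.
move=> Hl Hl'; apply/eqP; rewrite -subr_eq0; apply/eqP; apply: gnorm_le0 => e e0.
have e2 : 0 < e / 2 by lra.
have [n1 H1] := Hl _ e2; have [n2 H2] := Hl' _ e2.
have := H1 (maxn n1 n2) (leq_maxl _ _); have := H2 (maxn n1 n2) (leq_maxr _ _).
have := gnorm_sub_trans (u (maxn n1 n2)) l l'; rewrite (gnormBC l (u _)); lra.
Qed.

Lemma cvg_const (l : V) : cvg_wrt N (fun=> l) l.
Proof. by move=> e e0; exists 0%N => n _; rewrite subrr gnorm0. Qed.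

Lemma cvg_add (u v : nat -> V) (l m : V) :
  cvg_wrt N u l -> cvg_wrt N v m -> cvg_wrt N (fun n => u n + v n) (l + m).
Proof.
move=> Hl Hm e e0; have e2 : 0 < e / 2 by lra.
have [n1 H1] := Hl _ e2; have [n2 H2] := Hm _ e2.
exists (maxn n1 n2) => n; rewrite geq_max => /andP[/H1 {}H1 /H2 {}H2].
rewrite opprD addrACA; have := gnormD (u n - l) (v n - m); lra.
Qed.

Lemma cvg_eq (u v : nat -> V) (l : V) :
  (forall n, u n = v n) -> cvg_wrt N u l -> cvg_wrt N v l.
Proof. by move=> E H e /H[n0 {}H]; exists n0 => n /H; rewrite E. Qed.

Lemma cvg_shift (k : nat) (u : nat -> V) (l : V) :
  cvg_wrt N u l -> cvg_wrt N (fun n => u (k + n)%N) l.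
Proof.
by move=> H e /H[n0 {}H]; exists n0 => n n0n; apply/H/(leq_trans n0n)/leq_addl.
Qed.

Lemma cvg_gnorm_le (u : nat -> V) (l y : V) (c : R) :
  cvg_wrt N u l -> (forall n, N (y - u n) <= c) -> N (y - l) <= c.
Proof.
move=> H Hc; apply/ler_addgt0Pr => e /H[n /(_ n (leqnn n)) Hn].
have := gnorm_sub_trans (u n) y l; have := Hc n; lra.
Qed.

Lemma cvg_gnorm_bound (u : nat -> V) (l : V) (c : R) :
  cvg_wrt N u l -> (forall n, N (u n) <= c) -> N l <= c.
Proof.
move=> H Hc; rewrite -gnormN -sub0r; apply: cvg_gnorm_le H _ => n.
by rewrite sub0r gnormN.
Qed.

(** The increments of [r] dominate norms, so [r] is nondecreasing; once it is close to its supremum,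
    all later increments of [u] are small. *)
Lemma cauchy_dominated (u : nat -> V) (r : nat -> R) (B : R) :
  (forall n, N (u n.+1 - u n) <= r n.+1 - r n) -> (forall n, r n <= B) ->
  cauchy_wrt N u.
Proof.
move=> Hu HB.
have incr n k : N (u (n + k)%N - u n) <= r (n + k)%N - r n.
  elim: k => [|k IH]; first by rewrite addn0 !subrr gnorm0.
  rewrite addnS; apply: le_trans (gnorm_sub_trans (u (n + k)%N) _ _) _.
  have := Hu (n + k)%N; lra.
pose E : classical_sets.set R := fun s => exists n, s = r n.
have hE : classical_sets.has_sup E.
  split; first by exists (r 0%N); exists 0%N.
  by exists B => _ [n ->].
move=> e e0; have e2 : 0 < e / 2 by lra.
have [_ [n0 ->] Hn0] := sup_adherent e2 hE.
have rS n : r n <= sup E by apply: (ub_le_sup hE.2); exists n.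
have close n : (n0 <= n)%N -> N (u n - u n0) < e / 2.
  move=> /subnKC <-; apply: le_lt_trans (incr _ _) _.
  have := rS (n0 + (n - n0))%N; lra.
exists n0 => n m /close Hn /close Hm; have := gnorm_sub_trans (u n0) (u n) (u m).
rewrite (gnormBC (u n0) (u m)); lra.
Qed.

End GroupNorm.

Lemma cvg_map (R : realType) (V W : zmodType) (N : V -> R) (M : W -> R)
    (F : V -> W) (K : R) (u : nat -> V) (l : V) :
  group_norm N -> additive_fun F -> (forall x, M (F x) <= K * N x) ->
  cvg_wrt N u l -> cvg_wrt M (fun n => F (u n)) (F l).
Proof.
(* The constant [K] may be zero or negative, so [|K| + 1] is the divisor. *)
move=> hN FD FK H e e0; have K0 : 0 < `|K| + 1 by have := normr_ge0 K; lra.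
have [n0 Hn] := H _ (divr_gt0 e0 K0); exists n0 => n /Hn.
rewrite ltr_pdivlMr // -(additive_funB FD) => {}Hn.
apply: le_lt_trans (FK _) (le_lt_trans _ Hn).
rewrite mulrC ler_wpM2l ?(gnorm_ge0 hN) //; have := ler_norm K; lra.
Qed.

(** * The quadratic iteration behind square roots *)

Section Catalan.
Variables (R : realType) (V : zmodType) (N : V -> R).
Hypothesis hN : group_norm N.
Hypothesis cN : forall u, cauchy_wrt N u -> exists l, cvg_wrt N u l.

(* The iteration for [Q = L + Q^2], whose fixed point is [(1 - sqrt (1 - 4 L)) / 2];
   it needs no division in [V]. *)
Fixpoint catalan_iter (L : V -> V) (n : nat) (x : V) : V :=
  if n is k.+1 then L x + catalan_iter L k (catalan_iter L k x) else 0.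

Fixpoint catalan_real (m : R) (n : nat) : R :=
  if n is k.+1 then m + catalan_real m k ^+ 2 else 0.

(** The interval [[0, 2 m]] is stable, since [m + (2 m)^2 <= 2 m] when [4 m <= 1]. *)
Lemma catalan_real_bound (m : R) (n : nat) :
  0 <= m -> 4 * m <= 1 -> 0 <= catalan_real m n <= 2 * m.
Proof.
move=> m0 m4; elim: n => [|n /andP[IH1 IH2]] /=; first by rewrite lexx; lra.
by apply/andP; split; nra.
Qed.

Variables (L : V -> V) (m : R).
Hypotheses (LD : additive_fun L) (Lm : forall x, N (L x) <= m * N x).
Hypotheses (m0 : 0 <= m) (m4 : 4 * m <= 1).
Local Notation q := (catalan_iter L).
Local Notation r := (catalan_real m).

Lemma catalan_iterD (n : nat) : additive_fun (q n).
Proof.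
elim: n => [|n IH] x y /=; first by rewrite addr0.
by rewrite LD !IH; zmod.
Qed.

Lemma catalan_iter_bound (n : nat) (x : V) : N (q n x) <= r n * N x.
Proof.
elim: n x => [|n IH] x /=; first by rewrite (gnorm0 hN) mul0r.
apply: le_trans (gnormD hN _ _) _; have := Lm x; have := IH (q n x).
have := IH x; have /andP[] := catalan_real_bound n m0 m4.
move: (N x) (N (q n x)) (N (q n (q n x))) (N (L x)) (r n) => *; nra.
Qed.

(** The real iteration is a majorant: [q_{n+1}^2 - q_n^2] splits as [q_{n+1} (q_{n+1} - q_n) +
    (q_{n+1} - q_n) q_n], which is bounded by [(r_{n+1} + r_n) (r_{n+1} - r_n) = r_{n+2} -
    r_{n+1}]. *)
Lemma catalan_iter_step (n : nat) (x : V) :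
  N (q n.+1 x - q n x) <= (r n.+1 - r n) * N x.
Proof.
elim: n x => [|n IH] x.
  by rewrite /= !(subr0, addr0, expr0n).
have -> : q n.+2 x - q n.+1 x =
   q n.+1 (q n.+1 x - q n x) + (q n.+1 (q n x) - q n (q n x)).
  rewrite (additive_funB (@catalan_iterD n.+1)) /=; zmod.
apply: le_trans (gnormD hN _ _) _.
have := catalan_iter_bound n.+1 (q n.+1 x - q n x).
have := IH x; have := IH (q n x); have := catalan_iter_bound n x.
have /andP[r0 _] := catalan_real_bound n m0 m4.
have /andP[r1 _] := catalan_real_bound n.+1 m0 m4.
have : r n <= r n.+1.
  elim: (n) => [|k IHk]; first by rewrite /= expr0n addr0.
  have /andP[? _] := catalan_real_bound k m0 m4.
  by rewrite /= lerD2l lerXn2r ?nnegrE // (le_trans _ IHk).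
have -> : r n.+2 = m + r n.+1 ^+ 2 by [].
have : r n.+1 = m + r n ^+ 2 by [].
have := gnorm_ge0 hN x.
move: (N (q n x)) (N x) (r n) (r n.+1) r0 r1 => a b s t s0 t0 b0 -> st Ha.
move: (N _) (N _) (N _) => c d f; nra.
Qed.

Lemma catalan_limit_ex :
  exists Q : V -> V, forall x, cvg_wrt N (fun n => q n x) (Q x).
Proof.
suff H x : exists l, cvg_wrt N (fun n => q n x) l by have [Q] := choice H; exists Q.
apply/cN/(cauchy_dominated hN (r := fun n => r n * N x) (B := 2 * m * N x)) => n.
  by rewrite -mulrBl; apply: catalan_iter_step.
rewrite ler_wpM2r ?(gnorm_ge0 hN) //.
by have /andP[] := catalan_real_bound n m0 m4.
Qed.

Variable Q : V -> V.
Hypothesis HQ : forall x, cvg_wrt N (fun n => q n x) (Q x).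

Lemma catalan_limitD : additive_fun Q.
Proof.
move=> x y; apply: (cvg_unique hN (HQ (x + y))).
by apply: cvg_eq (cvg_add hN (HQ x) (HQ y)) => n; rewrite catalan_iterD.
Qed.

Lemma catalan_iter_bound2 (n : nat) (x : V) : N (q n x) <= 2 * m * N x.
Proof.
apply: le_trans (catalan_iter_bound n x) _.
rewrite ler_wpM2r ?(gnorm_ge0 hN) //.
by have /andP[] := catalan_real_bound n m0 m4.
Qed.

Lemma catalan_limit_bound (x : V) : N (Q x) <= 2 * m * N x.
Proof. exact: (cvg_gnorm_bound hN (HQ x) (fun n => catalan_iter_bound2 n x)). Qed.

Lemma catalan_limitE (x : V) : Q x = L x + Q (Q x).
Proof.
apply: (cvg_unique hN (cvg_shift 1 (HQ x))).
rewrite (_ : (fun n => _) = fun n => L x + q n (q n x)) //.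
apply: cvg_add => //; first exact: cvg_const.
move=> e e0; have e2 : 0 < e / 2 by lra.
have [n1 H1] := HQ x e2; have [n2 H2] := HQ (Q x) e2.
exists (maxn n1 n2) => n; rewrite geq_max => /andP[/H1 {}H1 /H2 {}H2].
(* Both occurrences of [q n] in [q n (q n x)] move with [n]; the limit passes through because every
   [q n] is Lipschitz with the same constant [2 m <= 1]. *)
have := gnorm_sub_trans hN (q n (Q x)) (q n (q n x)) (Q (Q x)).
have := catalan_iter_bound2 n (q n x - Q x).
rewrite (additive_funB (@catalan_iterD n)).
have : 2 * m * N (q n x - Q x) <= N (q n x - Q x).
  by rewrite ler_piMl ?(gnorm_ge0 hN) //; have := m4; have := m0; lra.
lra.
Qed.

End Catalan.

(** The iteration [u_{n+1} = y + L u_n] has increments at most [q^n N y], hence is dominated by the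
    partial sums of a geometric series. *)
Lemma contraction_solve (R : realType) (V : zmodType) (N : V -> R)
    (L : V -> V) (q : R) :
  group_norm N -> (forall u, cauchy_wrt N u -> exists l, cvg_wrt N u l) ->
  additive_fun L -> (forall x, N (L x) <= q * N x) -> 0 <= q -> q < 1 ->
  forall y, exists x, x - L x = y.
Proof.
move=> hN cN LD Lq q0 q1 y.
pose u n := iter n (fun x => y + L x) 0.
have uS n : N (u n.+1 - u n) <= q ^+ n * N y.
  elim: n => [|n IH].
    by rewrite /u /= (additive_fun0 LD) addr0 subr0 mul1r.
  have -> : u n.+2 - u n.+1 = L (u n.+1 - u n).
    by rewrite (additive_funB LD) /u /= -/(u n) -/(u n.+1) /=; zmod.
  by rewrite exprS -mulrA (le_trans (Lq _)) // ler_wpM2l.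
have [x Hx] : exists l, cvg_wrt N u l.
  apply: cN.
  apply: (cauchy_dominated hN (r := fun n => (1 - q ^+ n) / (1 - q) * N y)
           (B := (1 - q)^-1 * N y)) => n.
    rewrite (le_trans (uS n)) // -mulrBl ler_wpM2r ?(gnorm_ge0 hN) //.
    rewrite -mulrBl ler_pdivlMr ?subr_gt0 // exprS; lra.
  rewrite ler_wpM2r ?(gnorm_ge0 hN) // ler_pdivrMr ?subr_gt0 //.
  rewrite mulVf; last by rewrite subr_eq0; apply/eqP; lra.
  have : 0 <= q ^+ n by rewrite exprn_ge0.
  lra.
exists x; apply/eqP; rewrite subr_eq; apply/eqP.
apply: (cvg_unique hN (cvg_shift 1 Hx)).
rewrite (_ : (fun n => _) = fun n => y + L (u n)) //.
exact: (cvg_add hN (cvg_const hN _) (cvg_map hN LD Lq Hx)).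
Qed.

(** * Square roots in a C*-algebra *)

Section CstarBasics.
Variables (R : realType) (A : algType R[i]) (CA : cstar A).
Local Notation star := (cs_star CA).
Local Notation nrm := (cs_norm CA).
Local Notation "r %:c" := (Complex r 0) (at level 2, format "r %:c").

Lemma real_complexD (r s : R) : (r + s)%:c = r%:c + s%:c :> R[i].
Proof. exact: (rmorphD (real_complex R)). Qed.

Lemma real_complexN (r : R) : (- r)%:c = - r%:c :> R[i].
Proof. exact: (rmorphN (real_complex R)). Qed.

Lemma real_complexM (r s : R) : (r * s)%:c = r%:c * s%:c :> R[i].
Proof. exact: (rmorphM (real_complex R)). Qed.

Lemma normc_real (r : R) : ComplexField.Normc.normc r%:c = `|r|.
Proof. by rewrite /= expr0n addr0 sqrtr_sqr. Qed.

Lemma starD : additive_fun star. Proof. exact: cs_star_add. Qed.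
Lemma star0 : star 0 = 0. Proof. exact: additive_fun0 starD. Qed.
Lemma starB (a b : A) : star (a - b) = star a - star b.
Proof. exact: additive_funB starD a b. Qed.
Lemma starK (a : A) : star (star a) = a. Proof. exact: cs_star_invol. Qed.
Lemma starM (a b : A) : star (a * b) = star b * star a. Proof. exact: cs_star_mul. Qed.

Lemma star1 : star 1 = 1.
Proof. by rewrite -[RHS]starK -[star 1 in RHS]mulr1 starM starK mulr1. Qed.

Lemma starZ (r : R) (a : A) : star (r%:c *: a) = r%:c *: star a.
Proof. by rewrite cs_star_scale /= oppr0. Qed.

Lemma nrmZ (r : R) (a : A) : nrm (r%:c *: a) = `|r| * nrm a.
Proof. by rewrite cs_norm_scale normc_real. Qed.

Lemma nrmZ_ge0 (r : R) (a : A) : 0 <= r -> nrm (r%:c *: a) = r * nrm a.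
Proof. by move=> r0; rewrite nrmZ ger0_norm. Qed.

Lemma nrm_gnorm : group_norm nrm.
Proof.
split; last exact: cs_norm_eq0; last exact: cs_norm_triangle.
  by rewrite -(scale0r (0 : A)) -[0 : R[i]]/(0%:c) nrmZ normr0 mul0r.
move=> x; rewrite -scaleN1r -[1]/(1%:c) -real_complexN nrmZ.
by rewrite normrN normr1 mul1r.
Qed.

Lemma nrm_ge0 (a : A) : 0 <= nrm a. Proof. exact: cs_norm_ge0. Qed.
Lemma nrmM (a b : A) : nrm (a * b) <= nrm a * nrm b. Proof. exact: cs_norm_submul. Qed.

(** Cancel one factor in [|b|^2 = |b^* b| <= |b^*| |b|], then apply the result to [b^*] as well. *)
Lemma nrm_star (a : A) : nrm (star a) = nrm a.
Proof.
have le (b : A) : nrm b <= nrm (star b).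
  have [->|/eqP b0] := eqVneq (nrm b) 0; first exact: nrm_ge0.
  have {b0} : 0 < nrm b by rewrite lt_neqAle nrm_ge0 eq_sym; apply/andP; split; [apply/eqP|].
  by move=> b0; rewrite -(ler_pM2r b0) -expr2 -cs_norm_cstar nrmM.
by apply/eqP; rewrite eq_le le -{2}[a]starK le.
Qed.

Lemma nrm_starM (a : A) : nrm (star a * a) = nrm a ^+ 2.
Proof. exact: cs_norm_cstar. Qed.

Lemma nrm_sq (a : A) : star a = a -> nrm (a * a) = nrm a ^+ 2.
Proof. by move=> sa; rewrite -{1}sa nrm_starM. Qed.

Lemma nrm1 : nrm 1 = 1.
Proof.
have : nrm 1 = nrm 1 ^+ 2 by rewrite -nrm_sq ?star1 // mulr1.
have : nrm 1 != 0 by apply/eqP => /cs_norm_eq0/eqP; rewrite oner_eq0.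
by move=> n0 /eqP; rewrite expr2 -{1}[nrm 1]mulr1 (inj_eq (mulfI n0)) => /eqP.
Qed.

Lemma starM_eq0 (a : A) : star a * a = 0 -> a = 0.
Proof.
move=> aa; apply: (@cs_norm_eq0 _ _ CA); apply/eqP.
by rewrite -sqrf_eq0 -nrm_starM aa (gnorm0 nrm_gnorm).
Qed.

Lemma sq_eq0 (a : A) : star a = a -> a * a = 0 -> a = 0.
Proof. by move=> {1}<-; apply: starM_eq0. Qed.

Lemma cube_eq0 (a : A) : star a = a -> a * a * a = 0 -> a = 0.
Proof.
move=> sa a3; apply/(sq_eq0 sa)/sq_eq0; first by rewrite starM sa.
by rewrite mulrA a3 mul0r.
Qed.

Lemma cvg_Ml (a : A) (u : nat -> A) (l : A) :
  cvg_wrt nrm u l -> cvg_wrt nrm (fun n => a * u n) (a * l).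
Proof.
by apply: cvg_map nrm_gnorm _ (fun x => nrmM a x) => x y; rewrite mulrDr.
Qed.

Lemma cvg_Mr (a : A) (u : nat -> A) (l : A) :
  cvg_wrt nrm u l -> cvg_wrt nrm (fun n => u n * a) (l * a).
Proof.
apply: (cvg_map (K := nrm a) (F := fun x => x * a) nrm_gnorm).
  by move=> x y; rewrite mulrDl.
by move=> x; rewrite mulrC nrmM.
Qed.

Lemma cvg_star (u : nat -> A) (l : A) :
  cvg_wrt nrm u l -> cvg_wrt nrm (fun n => star (u n)) (star l).
Proof.
by apply: (cvg_map (K := 1) nrm_gnorm starD) => x; rewrite nrm_star mul1r.
Qed.

(** Multiplication by these elements is [catalan_iter] for left multiplication by [m]. As elements
    of [A] they can be starred and commuted past other elements. *)
Fixpoint catalan_elt (m : A) (n : nat) : A :=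
  if n is k.+1 then m + catalan_elt m k * catalan_elt m k else 0.

Lemma catalan_eltE (m : A) (n : nat) (x : A) :
  catalan_iter ( *%R m) n x = catalan_elt m n * x.
Proof.
elim: n x => [|n IH] x /=; first by rewrite mul0r.
by rewrite !IH mulrDl mulrA.
Qed.

Lemma catalan_elt_star (m : A) (n : nat) :
  star m = m -> star (catalan_elt m n) = catalan_elt m n.
Proof.
by move=> sm; elim: n => [|n IH] /=; rewrite ?star0 // starD starM !IH sm.
Qed.

Lemma catalan_elt_intertwine (m m' x : A) (n : nat) :
  m * x = x * m' -> catalan_elt m n * x = x * catalan_elt m' n.
Proof.
move=> mx; elim: n => [|n IH] /=; first by rewrite mul0r mulr0.
by rewrite mulrDl mulrDr mx -mulrA IH !mulrA IH.
Qed.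

Lemma catalan_elt_limit (m : A) : 4 * nrm m <= 1 ->
  exists p, [/\ cvg_wrt nrm (catalan_elt m) p, nrm p <= 2 * nrm m & p = m + p * p].
Proof.
move=> m4; have LD : additive_fun ( *%R m) by move=> x y; rewrite mulrDr.
have Lm x : nrm (m * x) <= nrm m * nrm x by apply: nrmM.
have [Q HQ] := catalan_limit_ex nrm_gnorm (@cs_complete _ _ CA) LD Lm (nrm_ge0 m) m4.
have Hp : cvg_wrt nrm (catalan_elt m) (Q 1).
  by apply: cvg_eq (HQ 1) => n; rewrite catalan_eltE mulr1.
have QE x : Q x = Q 1 * x.
  apply: (cvg_unique nrm_gnorm (HQ x)); apply: cvg_eq (cvg_Mr x Hp) => n.
  by rewrite catalan_eltE.
(* The limit operator is left multiplication by its value at the unit. *)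
exists (Q 1); split=> //.
  by have := catalan_limit_bound nrm_gnorm Lm (nrm_ge0 m) m4 HQ 1; rewrite nrm1 mulr1.
have := catalan_limitE nrm_gnorm LD Lm (nrm_ge0 m) m4 HQ 1.
by rewrite mulr1 (QE (Q 1)).
Qed.

(* [b] is the square root [sqrt t * sqrt (1 - (t - h) / t)] given by the power
   series of [sqrt (1 - z)]. *)
Definition series_root (t : R) (h b : A) : Prop :=
  exists2 p, cvg_wrt nrm (catalan_elt ((4 * t)^-1%:c *: (t%:c *: 1 - h))) p &
    b = (Num.sqrt t)%:c *: (1 - (p + p)).

(** With [m = (t - h) / (4 t)], the equation [p = m + p^2] gives [(1 - 2 p)^2 = 1 - 4 m = h / t].
    The norm bound lets the root inherit positivity, with [sqrt t] in place of [t]. *)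
Lemma series_root_ex (t : R) (h : A) : 0 < t -> nrm (t%:c *: 1 - h) <= t ->
  exists b, [/\ series_root t h b, b * b = h &
    nrm ((Num.sqrt t)%:c *: 1 - b) <= Num.sqrt t].
Proof.
move=> t0 ht; pose m := (4 * t)^-1%:c *: (t%:c *: 1 - h).
have m4 : 4 * nrm m <= 1.
  rewrite nrmZ_ge0 ?invr_ge0; last lra.
  by rewrite invfM mulrA mulrA divff ?pnatr_eq0 // mul1r mulrC ler_pdivrMr // mul1r.
have [p [Hp pm pE]] := catalan_elt_limit m4.
exists ((Num.sqrt t)%:c *: (1 - (p + p))); split; first by exists p.
  rewrite -scalerAl -scalerAr scalerA -real_complexM -expr2 sqr_sqrtr ?ltW //.
  have -> : (1 - (p + p)) * (1 - (p + p)) = 1 - 4%:c *: m.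
    have -> : 4%:c *: m = m + m + m + m.
      have -> : 4 = 1 + 1 + 1 + 1 :> R by lra.
      by rewrite !real_complexD !scalerDl scale1r.
    rewrite mulrBl !mulrBr !mul1r !mulr1 !mulrDl !mulrDr.
    have -> : m = p - p * p by rewrite {1}pE; zmod.
    zmod.
  rewrite scalerBr /m !scalerA -!real_complexM.
  have -> : t * (4 / (4 * t)) = 1 by field; rewrite gt_eqF.
  rewrite scale1r.
  zmod.
rewrite -scalerBr nrmZ_ge0 ?sqrtr_ge0 // ler_piMr ?sqrtr_ge0 //.
have -> : 1 - (1 - (p + p)) = p + p by zmod.
have := gnormD nrm_gnorm p p; lra.
Qed.

Lemma series_root_star (t : R) (h b : A) :
  star h = h -> series_root t h b -> star b = b.
Proof.
move=> sh [p Hp ->]; rewrite starZ starB star1 starD.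
suff -> : star p = p by [].
apply: (cvg_unique nrm_gnorm (cvg_star Hp)); apply: cvg_eq Hp => n.
by rewrite catalan_elt_star // starZ starB starZ star1 sh.
Qed.

(** The two roots are limits of the same polynomials in [h] and in [h'], because [t] is shared. With
    [h = h'] this says that the root commutes with whatever commutes with [h]. *)
Lemma series_root_intertwine (t : R) (h h' b b' x : A) :
  series_root t h b -> series_root t h' b' -> h * x = x * h' -> b * x = x * b'.
Proof.
move=> [p Hp ->] [p' Hp' ->] hx; rewrite -scalerAl -scalerAr; congr (_ *: _).
suff px : p * x = x * p' by rewrite mulrBl mulrBr mulrDl mulrDr px mul1r mulr1.
apply: (cvg_unique nrm_gnorm (cvg_Mr x Hp)); apply: cvg_eq (cvg_Ml x Hp') => n.
rewrite (@catalan_elt_intertwine _ ((4 * t)^-1%:c *: (t%:c *: 1 - h')) x) //.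
by rewrite -scalerAl -scalerAr mulrBl mulrBr hx -scalerAl -scalerAr mul1r mulr1.
Qed.

End CstarBasics.

(** * The positive cone *)

Lemma le_sqrtr (R : realType) (x t : R) : 0 <= x -> 0 <= t ->
  (x <= Num.sqrt t) = (x ^+ 2 <= t).
Proof. by move=> x0 t0; rewrite -{1}(ger0_norm x0) -sqrtr_sqr ler_sqrt. Qed.

Section Positivity.
Variables (R : realType) (A : algType R[i]) (CA : cstar A).
Local Notation star := (cs_star CA).
Local Notation nrm := (cs_norm CA).
Local Notation "r %:c" := (Complex r 0) (at level 2, format "r %:c").
Local Notation I := (Complex 0 1 : R[i]).

Lemma starI (a : A) : star (I *: a) = - (I *: star a).
Proof.
rewrite cs_star_scale -scaleNr; congr (_ *: _).
by apply/eqP; rewrite eq_complex /= oppr0 !eqxx.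
Qed.

Lemma scaleII (a : A) : I *: (I *: a) = - a.
Proof.
rewrite scalerA -scaleN1r; congr (_ *: _).
by apply/eqP; rewrite eq_complex /= !(mul0r, mulr0, mulr1) add0r oppr0 addr0 !eqxx.
Qed.

Lemma nrm_scalar (t : R) : 0 <= t -> nrm (t%:c *: 1) = t.
Proof. by move=> t0; rewrite nrmZ_ge0 // nrm1 mulr1. Qed.

(* [b + i c] is a multiple of a unitary. *)
Lemma nrm_sum_sq (b c : A) (t : R) : star b = b -> star c = c -> b * c = c * b ->
  0 <= t -> b * b + c * c = t%:c *: 1 -> nrm b <= Num.sqrt t.
Proof.
move=> sb sc bc t0 E.
have nt (x : A) : star x * x = t%:c *: 1 -> nrm x = Num.sqrt t.
  move=> xE; apply/eqP; rewrite -(eqrXn2 (n := 2)) ?nrm_ge0 ?sqrtr_ge0 //.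
  by rewrite sqr_sqrtr // -nrm_starM xE nrm_scalar.
have H1 : nrm (b + I *: c) = Num.sqrt t.
  apply: nt; rewrite starD starI sb sc -E mulrDl !mulrDr !mulNr.
  rewrite -!scalerAl -!scalerAr scaleII bc; zmod.
have H2 : nrm (b - I *: c) = Num.sqrt t.
  apply: nt; rewrite starB starI sb sc -E opprK mulrDl !mulrDr !mulrN.
  rewrite -!scalerAl -!scalerAr scaleII bc; zmod.
have : nrm (2%:c *: b) <= nrm (b + I *: c) + nrm (b - I *: c).
  have -> : 2%:c *: b = (b + I *: c) + (b - I *: c).
    have -> : 2 = 1 + 1 :> R by lra.
    rewrite real_complexD scalerDl scale1r; zmod.
  exact: (gnormD (nrm_gnorm CA)).
rewrite H1 H2 nrmZ_ge0; lra.
Qed.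

(* The spectrum-free description of self-adjoint elements with nonnegative
   spectrum; it coincides with [cs_pos], see [cs_posP]. *)
Definition kpos (h : A) : Prop :=
  star h = h /\ exists2 t, 0 < t & nrm (t%:c *: 1 - h) <= t.

Lemma kpos_star (h : A) : kpos h -> star h = h. Proof. by case. Qed.

(** The element [t - h^2] has a root [b] commuting with [h], and [b^2 + h^2 = t], so [nrm_sum_sq]
    bounds [|b|^2]. *)
Lemma nrm_sub_sq (h : A) (t : R) : star h = h -> 0 < t -> nrm h ^+ 2 <= t ->
  nrm (t%:c *: 1 - h * h) <= t.
Proof.
move=> sh t0 ht; pose k := t%:c *: 1 - h * h.
have tk : t%:c *: 1 - k = h * h by rewrite /k; zmod.
have sk : star k = k by rewrite /k starB starZ star1 starM sh.
have [b [rb bb _]] : exists b, [/\ series_root CA t k b, b * b = k &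
    nrm ((Num.sqrt t)%:c *: 1 - b) <= Num.sqrt t].
  by apply: series_root_ex; rewrite // tk nrm_sq.
have sb : star b = b := series_root_star sk rb.
have bh : b * h = h * b.
  apply: (series_root_intertwine rb rb).
  by rewrite /k mulrBl mulrBr -scalerAl -scalerAr mul1r mulr1 mulrA.
have : nrm b <= Num.sqrt t.
  by apply: (nrm_sum_sq sb sh bh (ltW t0)); rewrite bb /k; zmod.
by rewrite (le_sqrtr (nrm_ge0 CA b) (ltW t0)) -/k -bb nrm_sq.
Qed.

Lemma kpos_sq (h : A) : star h = h -> kpos (h * h).
Proof.
move=> sh; split; first by rewrite starM sh.
have h2 : 0 <= nrm h ^+ 2 by rewrite exprn_ge0 ?nrm_ge0.
by exists (nrm h ^+ 2 + 1); [lra | apply: nrm_sub_sq => //; lra].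
Qed.

Lemma kpos_root (h : A) : kpos h -> exists t b, [/\ 0 < t, series_root CA t h b,
  b * b = h, kpos b & nrm (t%:c *: 1 - h) <= t].
Proof.
case=> sh [t t0 ht]; have [b [rb bb bt]] := series_root_ex t0 ht.
exists t, b; split=> //; split; first exact: series_root_star sh rb.
by exists (Num.sqrt t); rewrite ?sqrtr_gt0.
Qed.

(** Writing [h] as a self-adjoint square frees the bound from the particular [t] that witnesses
    positivity; this uniformity makes the cone closed. *)
Lemma kpos_uniform (h : A) (t : R) : kpos h -> 0 < t -> nrm h <= t ->
  nrm (t%:c *: 1 - h) <= t.
Proof.
move=> /kpos_root[s [b [_ _ <- [sb _] _]]] t0.
by rewrite nrm_sq // => bt; apply: nrm_sub_sq.
Qed.

Lemma kpos0 : kpos 0.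
Proof. by rewrite -(mulr0 0); apply: kpos_sq; rewrite star0. Qed.

Lemma kposD (h k : A) : kpos h -> kpos k -> kpos (h + k).
Proof.
move=> [sh [t t0 ht]] [sk [s s0 ks]]; split; first by rewrite starD sh sk.
exists (t + s); first exact: addr_gt0.
have -> : (t + s)%:c *: 1 - (h + k) = (t%:c *: 1 - h) + (s%:c *: 1 - k) :> A.
  rewrite real_complexD scalerDl; zmod.
exact: le_trans (gnormD (nrm_gnorm CA) _ _) (lerD ht ks).
Qed.

Lemma kposZ (r : R) (h : A) : 0 <= r -> kpos h -> kpos (r%:c *: h).
Proof.
rewrite le_eqVlt => /predU1P[<-|r0]; first by rewrite scale0r => _; apply: kpos0.
move=> [sh [t t0 ht]]; split; first by rewrite starZ sh.
exists (r * t); first exact: mulr_gt0.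
by rewrite real_complexM -scalerA -scalerBr nrmZ_ge0 ?(ltW r0) // ler_pM2l.
Qed.

(** The roots of [k] and [t - k] commute and their squares add up to [t], so [nrm_sum_sq]
    applies. *)
Lemma kpos_le_nrm (k : A) (t : R) : 0 <= t -> kpos k -> kpos (t%:c *: 1 - k) ->
  nrm k <= t.
Proof.
move=> t0 /kpos_root[s [b [_ _ bb [sb _] _]]] /kpos_root[s' [c [_ rc cc [sc _] _]]].
have cb : c * b = b * c.
  apply: (series_root_intertwine rc rc).
  by rewrite -bb mulrBl mulrBr -scalerAl -scalerAr mul1r mulr1 mulrA.
rewrite -bb nrm_sq // -le_sqrtr ?nrm_ge0 //.
by apply: (nrm_sum_sq sb sc) => //; rewrite bb cc; zmod.
Qed.

Lemma kpos_nrm_sub (k : A) (t : R) : kpos k -> nrm k <= t -> kpos (t%:c *: 1 - k).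
Proof.
move=> pk kt; have t0 : 0 <= t := le_trans (nrm_ge0 CA k) kt.
split; first by rewrite starB starZ star1 kpos_star.
exists (t + 1); first lra.
have -> : (t + 1)%:c *: 1 - (t%:c *: 1 - k) = 1%:c *: 1 + k.
  by rewrite real_complexD scalerDl; zmod.
rewrite (le_trans (gnormD (nrm_gnorm CA) _ _)) // nrm_scalar //; lra.
Qed.

Lemma kpos_antisym (h : A) : kpos h -> kpos (- h) -> h = 0.
Proof.
move=> ph nh; apply/cs_norm_eq0/eqP; rewrite eq_le nrm_ge0 andbT.
by apply: kpos_le_nrm => //; rewrite scale0r sub0r.
Qed.

Lemma kpos_closed (u : nat -> A) (l : A) :
  cvg_wrt nrm u l -> (forall n, kpos (u n)) -> kpos l.
Proof.
move=> ul pu; have gN := nrm_gnorm CA; split.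
  apply: (cvg_unique gN (cvg_star ul)); apply: cvg_eq ul => n.
  by rewrite kpos_star.
have [n0 Hn] := ul 1 ltr01; pose t := nrm l + 1.
have t0 : 0 < t by rewrite /t; have := nrm_ge0 CA l; lra.
exists t => //; apply: (cvg_gnorm_le gN (cvg_shift n0 ul)) => n.
apply: kpos_uniform => //.
have := Hn (n0 + n)%N (leq_addr _ _).
have := gnormD gN (u (n0 + n)%N - l) l; rewrite subrK /t; lra.
Qed.

(** The root [c] of [k] commutes with [n], so [n k n] is the square of the self-adjoint [c n].
    Conjugation by arbitrary elements has to wait for [kpos_starM]. *)
Lemma kpos_conj_comm (n k : A) : star n = n -> kpos k -> k * n = n * k ->
  kpos (n * k * n).
Proof.
move=> sn /kpos_root[s [c [_ rc cc [sc _] _]]] kn.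
have cn : c * n = n * c := series_root_intertwine rc rc kn.
have -> : n * k * n = (c * n) * (c * n).
  by rewrite -cc {1}cn !mulrA.
by apply: kpos_sq; rewrite starM sn sc cn.
Qed.

(** For [d = k - k'], commutation gives [d (k + k') = 0]. Hence the positive elements [d k d] and
    [d k' d] are opposite, both vanish, and [d^3 = 0]. *)
Lemma kpos_sq_inj (k k' : A) : kpos k -> kpos k' -> k * k' = k' * k ->
  k * k = k' * k' -> k = k'.
Proof.
move=> pk pk' C E; pose d := k - k'.
have sd : star d = d by rewrite starB !kpos_star.
have kd : k * d = d * k by rewrite mulrBl mulrBr C.
have kd' : k' * d = d * k' by rewrite mulrBl mulrBr C.
have sum0 : d * k * d = - (d * k' * d).
  apply/eqP; rewrite -subr_eq0 opprK -mulrDl -mulrDr.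
  have -> : d * (k + k') = 0 by rewrite mulrBl !mulrDr E C; zmod.
  by rewrite mul0r.
have dkd : d * k * d = 0.
  by apply: kpos_antisym; rewrite ?sum0 ?opprK -?sum0; apply: kpos_conj_comm.
have dkd' : d * k' * d = 0.
  by apply/eqP; rewrite -oppr_eq0 -sum0 dkd.
apply/eqP; rewrite -subr_eq0; apply/eqP/(cube_eq0 sd).
by rewrite -[d * d * d]/(d * (k - k') * d) (mulrBr d k) (mulrBl d (d * k)) dkd dkd' subrr.
Qed.

Lemma kpos_series_root_sq (k b : A) (t : R) : kpos k -> nrm (k * k) <= t -> 0 < t ->
  series_root CA t (k * k) b -> b = k.
Proof.
move=> pk kt t0 rb; have sk := kpos_star pk.
have [b' [rb' bb' bt']] := series_root_ex t0 (kpos_uniform (kpos_sq sk) t0 kt).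
(* Intertwining by [1] is uniqueness of the series root. *)
have <- : b' = b.
  by have := series_root_intertwine rb' rb (commr1 _); rewrite mulr1 mul1r.
have kk : star (k * k) = k * k by rewrite starM sk.
apply: kpos_sq_inj => //.
  split; first exact: series_root_star kk rb'.
  by exists (Num.sqrt t); rewrite ?sqrtr_gt0.
by apply: (series_root_intertwine rb' rb'); rewrite mulrA.
Qed.

(* With [y = x x^*] and [z = - x^* x] both positive, [y^2 x = x z^2], hence
   [y x = x z] by taking square roots; but [y x = - x z]. *)
Lemma starM_kpos_opp (x : A) : kpos (- (star x * x)) -> x = 0.
Proof.
set z := - _ => pz; pose y := x * star x.
have py : kpos y.
  (* Up to a factor, [s] and [w] are the real and imaginary parts of [x]:
     [s^2 + w^2 = 2 (x x^* + x^* x)], and adding [2 z] leaves [2 y]. *)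
  pose s := x + star x; pose w := I *: (x - star x).
  have ss : star s = s by rewrite /s starD starK; zmod.
  have sw : star w = w by rewrite /w starI starB starK -scalerN; congr (_ *: _); zmod.
  have <- : 2^-1%:c *: (s * s + w * w + (z + z)) = y.
    have -> : s * s + w * w + (z + z) = y + y.
      rewrite /w -scalerAl -scalerAr scaleII /s mulrBl mulrDl !mulrBr !mulrDr.
      by rewrite /y /z; zmod.
    have -> : y + y = 2%:c *: y.
      have -> : 2 = 1 + 1 :> R by lra.
      by rewrite real_complexD scalerDl scale1r.
    by rewrite scalerA -real_complexM mulVf ?pnatr_eq0 // scale1r.
  apply: kposZ; first by rewrite invr_ge0.
  by do ![apply: kposD => //]; apply: kpos_sq.
have yx : y * x = - (x * z) by rewrite /y /z mulrN opprK mulrA.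
have y2x : y * y * x = x * (z * z).
  by rewrite -mulrA yx mulrN mulrA yx mulNr opprK mulrA.
pose t := nrm (y * y) + nrm (z * z) + 1.
have ny := nrm_ge0 CA (y * y); have nz := nrm_ge0 CA (z * z).
have t0 : 0 < t by rewrite /t; lra.
have ty : nrm (y * y) <= t by rewrite /t; lra.
have tz : nrm (z * z) <= t by rewrite /t; lra.
have [b [rb _ _]] := series_root_ex t0 (kpos_uniform (kpos_sq (kpos_star py)) t0 ty).
have [c [rc _ _]] := series_root_ex t0 (kpos_uniform (kpos_sq (kpos_star pz)) t0 tz).
have := series_root_intertwine rb rc y2x.
rewrite (kpos_series_root_sq py ty t0 rb) (kpos_series_root_sq pz tz t0 rc) yx => E.
have xz : x * z = 0.
  have : 2%:c *: (x * z) = 0.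
    have -> : 2 = 1 + 1 :> R by lra.
    by rewrite real_complexD scalerDl scale1r -{1}E addNr.
  move=> /(congr1 (fun v => 2^-1%:c *: v)).
  by rewrite scaler0 scalerA -real_complexM mulVf ?pnatr_eq0 // scale1r.
have z0 : z = 0.
  by apply: (sq_eq0 (kpos_star pz)); rewrite {1}/z mulNr -mulrA xz mulr0 oppr0.
by apply: (@starM_eq0 _ _ CA); apply/eqP; rewrite -oppr_eq0 -/z z0.
Qed.

(* With [k = |h|] and [n = k - h], [(b n)^* (b n) = n h n = - n k n]. *)
Lemma kpos_starM (b : A) : kpos (star b * b).
Proof.
set h := star b * b; have sh : star h = h by rewrite starM starK.
have p2 := kpos_sq sh.
have [t [k [t0 rk kk pk _]]] := kpos_root p2.
have kh : k * h = h * k by apply: (series_root_intertwine rk rk); rewrite mulrA.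
pose n := k - h; have sn : star n = n by rewrite starB sh kpos_star.
have nh : n * h = - (n * k) by rewrite /n !mulrBl kk kh; zmod.
have nkn : n * k * n = 0.
  have E : star (b * n) * (b * n) = - (n * k * n).
    by rewrite starM sn !mulrA -(mulrA n) -/h nh mulNr.
  have bn : b * n = 0.
    apply: starM_kpos_opp; rewrite E opprK; apply: kpos_conj_comm => //.
    by rewrite mulrBr mulrBl kh.
  by apply/eqP; rewrite -oppr_eq0 -E bn mulr0.
suff n0 : n = 0 by have -> : h = k; first by apply/eqP; rewrite eq_sym -subr_eq0 -/n n0.
(* Here [n^3 = n k n - n h n], and [n h n = - n k n], so both terms vanish. *)
apply: (cube_eq0 sn); rewrite -[n * n * n]/(n * (k - h) * n) (mulrBr n k) (mulrBl n (n * k)).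
rewrite nkn nh mulNr nkn; zmod.
Qed.

Lemma cs_posP (a : A) : cs_pos CA a <-> kpos a.
Proof.
split=> [[b ->]|]; first exact: kpos_starM.
by move=> /kpos_root[t [b [_ _ <- [sb _] _]]]; exists b; rewrite sb.
Qed.

Local Notation pos := (cs_pos CA).

Lemma cs_pos_starM (b : A) : pos (star b * b). Proof. by exists b. Qed.

Lemma cs_pos_Mstar (b : A) : pos (b * star b).
Proof. by exists (star b); rewrite starK. Qed.

Lemma cs_pos0 : pos 0. Proof. by exists 0; rewrite mulr0. Qed.

Lemma cs_posD (a b : A) : pos a -> pos b -> pos (a + b).
Proof. by move=> /cs_posP pa /cs_posP pb; apply/cs_posP/kposD. Qed.

Lemma cs_posZ (r : R) (a : A) : 0 <= r -> pos a -> pos (r%:c *: a).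
Proof. by move=> r0 /cs_posP pa; apply/cs_posP/kposZ. Qed.

Lemma cs_pos_conj (c a : A) : pos a -> pos (star c * a * c).
Proof. by move=> [b ->]; exists (b * c); rewrite starM !mulrA. Qed.

Lemma cs_pos_sum (I : Type) (r : seq I) (P : pred I) (F : I -> A) :
  (forall i, P i -> pos (F i)) -> pos (\sum_(i <- r | P i) F i).
Proof. by move=> HF; elim/big_ind: _ => //; [apply: cs_pos0|apply: cs_posD]. Qed.

Lemma cs_pos_closed (u : nat -> A) (l : A) :
  cvg_wrt nrm u l -> (forall n, pos (u n)) -> pos l.
Proof. by move=> ul pu; apply/cs_posP/(kpos_closed ul) => n; apply/cs_posP. Qed.

Lemma cs_pos_nrm_sub (a : A) (t : R) : pos a -> nrm a <= t -> pos (t%:c *: 1 - a).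
Proof. by move=> /cs_posP pa at_; apply/cs_posP/kpos_nrm_sub. Qed.

Lemma cs_le_antisym (a b : A) : cs_le CA a b -> cs_le CA b a -> a = b.
Proof.
move=> /cs_posP ab /cs_posP ba; apply/esym/eqP; rewrite -subr_eq0; apply/eqP.
by apply: kpos_antisym; rewrite ?opprB.
Qed.

Lemma cs_le_trans (b a c : A) : cs_le CA a b -> cs_le CA b c -> cs_le CA a c.
Proof. by rewrite /cs_le => ab bc; rewrite -(subrKA b) ; apply: cs_posD. Qed.

(** Add [|b| - b >= 0] to [b - a >= 0] and read off the norm of [a] from [kpos_le_nrm]. *)
Lemma cs_le_nrm (a b : A) : pos a -> cs_le CA a b -> nrm a <= nrm b.
Proof.
move=> pa ab; have pb : pos b by rewrite -[b](subrK a); apply: cs_posD.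
apply: kpos_le_nrm; [exact: nrm_ge0 | exact/cs_posP | apply/cs_posP].
have -> : (nrm b)%:c *: 1 - a = ((nrm b)%:c *: 1 - b) + (b - a) :> A by zmod.
by apply: cs_posD => //; apply: cs_pos_nrm_sub.
Qed.

(* The expression is [<a x - y, a x - y>] for a form with [p = <x,x>],
   [c = <x,y>] and [q = <y,y>]. *)
Lemma cauchy_schwarz_abstract (p c q : A) : pos p ->
  (forall a, pos (a * p * star a - a * c - star c * star a + q)) ->
  nrm c ^+ 2 <= nrm p * nrm q.
Proof.
move=> pp H; apply/ler_addgt0Pr => e e0.
(* The slack [d] keeps [M = |p| + d] invertible even when [p = 0], at a cost [d |q| <= e]. *)
pose d := e / (nrm q + 1).
have q0 := nrm_ge0 CA q; have p0 := nrm_ge0 CA p.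
have d0 : 0 < d by rewrite divr_gt0 //; lra.
have de : d * nrm q <= e.
  by rewrite /d mulrAC ler_pdivrMr; [rewrite mulrDr mulr1; nra | lra].
pose M := nrm p + d; have M0 : 0 < M by rewrite /M; lra.
have pM : nrm p <= M by rewrite /M; lra.
suff : M^-1 * nrm c ^+ 2 <= nrm q.
  by rewrite ler_pdivrMl // /M mulrDl => /le_trans; apply; rewrite lerD2l.
rewrite -nrm_starM -(nrmZ_ge0 CA _ (r := M^-1)) ?invr_ge0 ?(ltW M0) //.
apply: cs_le_nrm.
  by apply: cs_posZ; [rewrite invr_ge0 ltW | exact: cs_pos_starM].
(* Take [a = M^-1 c^*]; replacing [p] by the larger [M] collapses the expression to
   [q - M^-1 c^* c]. *)
have := cs_posD (H (M^-1%:c *: star c))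
  (cs_posZ (sqr_ge0 M^-1) (cs_pos_conj c (cs_pos_nrm_sub pp pM))).
rewrite starZ starK !(mulrBr, mulrBl) -!scalerAl -!scalerAr !mulr1 -!scalerAl scalerBr.
rewrite !scalerA -!real_complexM; congr (pos _).
have -> : M^-1 ^+ 2 * M = M^-1 by field; rewrite gt_eqF.
rewrite /cs_le expr2; zmod.
Qed.

End Positivity.

(** * Operators on Hilbert modules *)

Section HilbertModule.
Variables (R : realType) (A : algType R[i]) (CA : cstar A).
Variables (H : lmodType A) (HM : hilbert_module CA H).
Local Notation star := (cs_star CA).
Local Notation nrm := (cs_norm CA).
Local Notation ip := (hm_ip HM).
Local Notation N := (hnorm HM).
Local Notation pos := (cs_pos CA).
Local Notation "r %:c" := (Complex r 0) (at level 2, format "r %:c").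

Lemma ipDl (x y z : H) : ip (x + y) z = ip x z + ip y z.
Proof. by rewrite -[x]scale1r hm_ip_linl mul1r scale1r. Qed.

Lemma ip0l (z : H) : ip 0 z = 0.
Proof. exact: (additive_fun0 (fun x y => ipDl x y z)). Qed.

Lemma ipNl (x z : H) : ip (- x) z = - ip x z.
Proof. exact: (additive_funN (fun x y => ipDl x y z)). Qed.

Lemma ipBl (x y z : H) : ip (x - y) z = ip x z - ip y z.
Proof. by rewrite ipDl ipNl. Qed.

Lemma ipZl (a : A) (x z : H) : ip (a *: x) z = a * ip x z.
Proof. by rewrite -[a *: x]addr0 hm_ip_linl ip0l addr0. Qed.

Lemma ip_star (x y : H) : star (ip x y) = ip y x.
Proof. by rewrite -hm_ip_sym. Qed.

Lemma ipDr (x y z : H) : ip z (x + y) = ip z x + ip z y.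
Proof. by rewrite -!(ip_star _ z) ipDl starD. Qed.

Lemma ipNr (x z : H) : ip z (- x) = - ip z x.
Proof. exact: (additive_funN (fun x y => ipDr x y z)). Qed.

Lemma ipBr (x y z : H) : ip z (x - y) = ip z x - ip z y.
Proof. by rewrite ipDr ipNr. Qed.

Lemma ip0r (z : H) : ip z 0 = 0.
Proof. exact: (additive_fun0 (fun x y => ipDr x y z)). Qed.

Lemma ipZr (a : A) (x z : H) : ip z (a *: x) = ip z x * star a.
Proof. by rewrite -!(ip_star _ z) ipZl starM. Qed.

Lemma ip_ext (x x' : H) : (forall y, ip x y = ip x' y) -> x = x'.
Proof.
move=> E; apply/eqP; rewrite -subr_eq0; apply/eqP/(hm_ip_def (h := HM)).
by rewrite ipBl E subrr.
Qed.

Lemma hnorm_ge0 (x : H) : 0 <= N x. Proof. exact: sqrtr_ge0. Qed.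

Lemma hnorm_sq (x : H) : N x ^+ 2 = nrm (ip x x).
Proof. by rewrite sqr_sqrtr // nrm_ge0. Qed.

(** Definiteness is not assumed, so this covers both the inner product and the forms [<Q u, v>] of
    positive operators. *)
Lemma form_cauchy_schwarz (f : H -> H -> A) :
  (forall x y z, f (x + y) z = f x z + f y z) ->
  (forall a x z, f (a *: x) z = a * f x z) ->
  (forall x y, star (f x y) = f y x) -> (forall x, pos (f x x)) ->
  forall x y, nrm (f x y) ^+ 2 <= nrm (f x x) * nrm (f y y).
Proof.
move=> fD fZ fS fp x y; apply: cauchy_schwarz_abstract => // a.
have fDr u v z : f z (u + v) = f z u + f z v by rewrite -!(fS _ z) fD starD.
have fZr u z : f z (a *: u) = f z u * star a by rewrite -!(fS _ z) fZ starM.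
have fNl u z : f (- u) z = - f u z.
  exact: (additive_funN (fun u v => fD u v z)).
have fNr u z : f z (- u) = - f z u.
  exact: (additive_funN (fun u v => fDr u v z)).
have := fp (a *: x - y); rewrite !(fD, fDr, fZ, fZr, fNl, fNr) fS; congr (pos _).
zmod.
Qed.

Lemma ip_cauchy_schwarz (x y : H) : nrm (ip x y) <= N x * N y.
Proof.
rewrite -ler_sqr ?nnegrE ?nrm_ge0 ?mulr_ge0 ?hnorm_ge0 //.
rewrite exprMn !hnorm_sq; apply: form_cauchy_schwarz.
- exact: ipDl.
- exact: ipZl.
- exact: ip_star.
- exact: hm_ip_pos.
Qed.

Lemma hnorm_gnorm : group_norm N.
Proof.
split.
- by rewrite /hnorm ip0l (gnorm0 (nrm_gnorm CA)) sqrtr0.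
- by move=> x; rewrite /hnorm ipNl ipNr opprK.
- move=> x y; rewrite -ler_sqr ?nnegrE ?addr_ge0 ?hnorm_ge0 //.
  rewrite sqrrD !hnorm_sq ipDl !ipDr.
  have gD := gnormD (nrm_gnorm CA).
  have := ip_cauchy_schwarz x y; have := ip_cauchy_schwarz y x.
  have := gD (ip x x + ip x y) (ip y x + ip y y).
  have := gD (ip x x) (ip x y); have := gD (ip y x) (ip y y).
  rewrite mulr2n; lra.
- move=> x /eqP; rewrite -sqrf_eq0 hnorm_sq => /eqP/cs_norm_eq0.
  exact: hm_ip_def.
Qed.

Lemma hnorm_complete (u : nat -> H) :
  cauchy_wrt N u -> exists l, cvg_wrt N u l.
Proof. exact: hm_complete. Qed.

Lemma cvg_ipl (y : H) (u : nat -> H) (l : H) :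
  cvg_wrt N u l -> cvg_wrt nrm (fun n => ip (u n) y) (ip l y).
Proof.
apply: (cvg_map (K := N y) (F := fun x => ip x y) hnorm_gnorm).
  by move=> ? ?; rewrite ipDl.
by move=> x; rewrite mulrC ip_cauchy_schwarz.
Qed.

Lemma cvg_ipr (y : H) (u : nat -> H) (l : H) :
  cvg_wrt N u l -> cvg_wrt nrm (fun n => ip y (u n)) (ip y l).
Proof.
move=> /(cvg_ipl y)/cvg_star; rewrite ip_star; apply: cvg_eq => n.
by rewrite ip_star.
Qed.

(** The module carries only an action of [A], so a real scalar acts through the corresponding
    multiple of the unit. *)
Definition hscale (r : R) (x : H) : H := r%:c%:A *: x.

Lemma hscaleM (r s : R) (x : H) : hscale r (hscale s x) = hscale (r * s) x.
Proof. by rewrite /hscale scalerA mulr_algl scalerA -real_complexM. Qed.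

Lemma hscale1 (x : H) : hscale 1 x = x.
Proof. by rewrite /hscale (_ : 1%:c = 1) // !scale1r. Qed.

Lemma hscaleBr (r : R) (x y : H) : hscale r (x - y) = hscale r x - hscale r y.
Proof. exact: scalerBr. Qed.

Lemma ip_hscalel (r : R) (x y : H) : ip (hscale r x) y = r%:c *: ip x y.
Proof. by rewrite ipZl mulr_algl. Qed.

Lemma ip_hscaler (r : R) (x y : H) : ip x (hscale r y) = r%:c *: ip x y.
Proof. by rewrite ipZr starZ star1 mulr_algr. Qed.

Lemma hnorm_hscale (r : R) (x : H) : 0 <= r -> N (hscale r x) = r * N x.
Proof.
move=> r0; rewrite {1}/hnorm ip_hscalel ip_hscaler !nrmZ_ge0 // -hnorm_sq.
by rewrite mulrA -expr2 -exprMn sqrtr_sqr ger0_norm // mulr_ge0 ?hnorm_ge0.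
Qed.

Lemma adjoint_sym (T T' : H -> H) : is_adjoint HM T T' -> is_adjoint HM T' T.
Proof. by move=> TT x y; rewrite -ip_star -TT ip_star. Qed.

Lemma adjoint_additive (T T' : H -> H) : is_adjoint HM T T' -> additive_fun T.
Proof. by move=> TT x y; apply: ip_ext => z; rewrite ipDl !TT ipDl. Qed.

Lemma adjoint_linear (T T' : H -> H) (a : A) (x : H) :
  is_adjoint HM T T' -> T (a *: x) = a *: T x.
Proof. by move=> TT; apply: ip_ext => z; rewrite ipZl !TT ipZl. Qed.

Lemma adjoint_hscale (T T' : H -> H) (r : R) (x : H) :
  is_adjoint HM T T' -> T (hscale r x) = hscale r (T x).
Proof. exact: adjoint_linear. Qed.

(** Cancel [|T' x|] in [|T' x|^2 = |<T T' x, x>| <= K |T' x| |x|]. *)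
Lemma adjoint_bounded (T T' : H -> H) (K : R) : is_adjoint HM T T' ->
  (forall x, N (T x) <= K * N x) -> forall x, N (T' x) <= K * N x.
Proof.
move=> TT TK x; have := ip_cauchy_schwarz (T (T' x)) x.
rewrite TT -hnorm_sq => le2; have := hnorm_ge0 (T' x).
rewrite le_eqVlt => /predU1P[E|N0]; last first.
  rewrite -(ler_pM2l N0) -expr2 (le_trans le2) //.
  by rewrite mulrCA mulrA ler_wpM2r ?hnorm_ge0 // TK.
(* When [T' x = 0] it remains to see [0 <= K |x|]; the sign of [K] is unknown, but
   [0 <= |T x| <= K |x|]. *)
rewrite -E; have := TK x; have := hnorm_ge0 (T x); exact: le_trans.
Qed.

Lemma adjoint_is_operator (T T' : H -> H) (K : R) : is_adjoint HM T T' ->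
  (forall x, N (T x) <= K * N x) -> is_operator HM T.
Proof.
move=> TT TK; split; [exact: adjoint_additive TT | | by exists K | by exists T'].
by move=> a x; apply: adjoint_linear TT.
Qed.

Lemma adjoint_sub_scale (T : H -> H) (r : R) : is_adjoint HM T T ->
  is_adjoint HM (fun x => hscale r (x - T x)) (fun x => hscale r (x - T x)).
Proof. by move=> TT x y; rewrite ip_hscalel ip_hscaler ipBl ipBr TT. Qed.

(* [1 - P] is the square root of [1 - Q]. *)
Lemma operator_sqrt (Q : H -> H) (q : R) : is_adjoint HM Q Q ->
  0 <= q -> q <= 1 -> (forall x, N (Q x) <= q * N x) ->
  exists P : H -> H, [/\ is_adjoint HM P P, forall x, N (P x) <= q * N x &
    forall x, (x - P x) - P (x - P x) = x - Q x].
Proof.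
move=> QQ q0 q1 Qq; pose L x := hscale 4^-1 (Q x).
have LL : is_adjoint HM L L by move=> x y; rewrite ip_hscalel ip_hscaler QQ.
have LD := adjoint_additive LL.
have Lm x : N (L x) <= q / 4 * N x.
  by rewrite hnorm_hscale ?invr_ge0 // mulrAC mulrC ler_wpM2r ?invr_ge0.
have m0 : 0 <= q / 4 by lra.
have m4 : 4 * (q / 4) <= 1 by lra.
have [C HC] := catalan_limit_ex hnorm_gnorm hnorm_complete LD Lm m0 m4.
have CD := catalan_limitD hnorm_gnorm LD HC.
have iter_sym n x y : ip (catalan_iter L n x) y = ip x (catalan_iter L n y).
  elim: n x y => [|n IH] x y /=; first by rewrite ip0l ip0r.
  by rewrite ipDl ipDr LL !IH.
have CC : is_adjoint HM C C.
  move=> x y; apply: (cvg_unique (nrm_gnorm CA) (cvg_ipl y (HC x))).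
  by apply: cvg_eq (cvg_ipr x (HC y)) => n; rewrite iter_sym.
(* As [C = L + C^2] and [Q = 4 L], one has [(1 - 2 C)^2 = 1 - 4 (C - C^2) = 1 - Q]. *)
exists (fun x => C x + C x); split.
- by move=> x y; rewrite ipDl ipDr CC.
- move=> x; have := gnormD hnorm_gnorm (C x) (C x).
  have := catalan_limit_bound hnorm_gnorm Lm m0 m4 HC x; lra.
move=> x; have CE := catalan_limitE hnorm_gnorm LD Lm m0 m4 HC x.
have -> : Q x = L x + L x + L x + L x.
  apply: ip_ext => y; rewrite !ipDl !ip_hscalel -!scalerDl -!real_complexD.
  have -> : 4^-1 + 4^-1 + 4^-1 + 4^-1 = 1 :> R by lra.
  by rewrite scale1r.
have -> : L x = C x - C (C x) by rewrite {1}CE; zmod.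
rewrite (additive_funB CD) !CD; zmod.
Qed.

(** The operator [T' T / K^2] has norm at most [1], the boundary case of [operator_sqrt]. The
    resulting self-adjoint root turns [K^2 <x,x> - <T x, T x>] into a multiple of some [<z,z>]. *)
Lemma operator_le (T T' : H -> H) (K : R) : is_adjoint HM T T' -> 0 < K ->
  (forall x, N (T x) <= K * N x) ->
  forall x, cs_le CA (ip (T x) (T x)) ((K ^+ 2)%:c *: ip x x).
Proof.
move=> TT K0 TK x; have K2 : 0 < K ^+ 2 by rewrite exprn_gt0.
pose Q y := hscale (K ^- 2) (T' (T y)).
have QQ : is_adjoint HM Q Q.
  by move=> y z; rewrite ip_hscalel ip_hscaler -TT (adjoint_sym TT).
have [||y|P [PP _ PE]] := operator_sqrt (q := 1) QQ.
- exact: ler01.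
- exact: lexx.
- rewrite hnorm_hscale ?invr_ge0 ?(ltW K2) // mul1r ler_pdivrMl // expr2 -mulrA.
  rewrite (le_trans (adjoint_bounded TT TK _)) // ler_wpM2l ?(ltW K0) //.
rewrite /cs_le.
have -> : (K ^+ 2)%:c *: ip x x - ip (T x) (T x) =
          (K ^+ 2)%:c *: ip (x - P x) (x - P x).
  have -> : ip (x - P x) (x - P x) = ip (x - Q x) x.
    by rewrite -PE [RHS]ipBl PP ipBr.
  rewrite ipBl ip_hscalel scalerBr scalerA -real_complexM mulfV ?gt_eqF //.
  by rewrite scale1r (adjoint_sym TT).
exact: cs_posZ (ltW K2) (hm_ip_pos HM _).
Qed.

End HilbertModule.

(** * Positive invertible square roots of operators bounded below *)

Section PositiveRoot.
Variables (R : realType) (A : algType R[i]) (CA : cstar A).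
Variables (H : lmodType A) (HM : hilbert_module CA H).
Local Notation nrm := (cs_norm CA).
Local Notation ip := (hm_ip HM).
Local Notation N := (hnorm HM).
Local Notation pos := (cs_pos CA).
Local Notation "r %:c" := (Complex r 0) (at level 2, format "r %:c").

(** Cauchy-Schwarz for the form [<Q u, v>] at [u = y], [v = Q y] gives
    [|Q y|^4 <= q |y|^2 q |Q y|^2]. *)
Lemma operator_form_bound (Q : H -> H) (q : R) : is_adjoint HM Q Q -> 0 <= q ->
  (forall y, pos (ip (Q y) y)) ->
  (forall y, cs_le CA (ip (Q y) y) (q%:c *: ip y y)) ->
  forall y, N (Q y) <= q * N y.
Proof.
move=> QQ q0 Qpos Qq y.
have fq z : nrm (ip (Q z) z) <= q * N z ^+ 2.
  by rewrite hnorm_sq -nrmZ_ge0 //; apply: cs_le_nrm.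
have CS : nrm (ip (Q y) (Q y)) ^+ 2 <= nrm (ip (Q y) y) * nrm (ip (Q (Q y)) (Q y)).
  apply: (form_cauchy_schwarz (f := fun u v => ip (Q u) v)) => //.
  - by move=> u v z; rewrite (adjoint_additive QQ) ipDl.
  - by move=> a u z; rewrite (adjoint_linear a u QQ) ipZl.
  - by move=> u v; rewrite ip_star QQ.
rewrite -hnorm_sq in CS.
have [y0 Qy0] := (hnorm_ge0 HM y, hnorm_ge0 HM (Q y)).
have f0 := fq y; have f1 := fq (Q y).
move: Qy0; rewrite le_eqVlt => /predU1P[<-|Qy0]; first by rewrite mulr_ge0.
have Q2 : 0 < N (Q y) ^+ 2 by rewrite exprn_gt0.
rewrite -ler_sqr ?nnegrE ?mulr_ge0 ?(ltW Qy0) // -(ler_pM2r Q2) -expr2.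
apply: le_trans CS _; apply: le_trans (ler_pM (nrm_ge0 CA _) (nrm_ge0 CA _) f0 f1) _.
by rewrite exprMn expr2 le_eqVlt; apply/orP; left; apply/eqP; ring.
Qed.

Lemma positive_operator_root (S : H -> H) (C D : R) :
  is_adjoint HM S S -> 0 < C -> 0 < D ->
  (forall y, cs_le CA (C%:c *: ip y y) (ip (S y) y)) ->
  (forall y, cs_le CA (ip (S y) y) (D%:c *: ip y y)) ->
  exists T Ti : H -> H,
    [/\ is_adjoint HM T T, is_operator HM T, op_positive HM T &
        forall y, T (T y) = S y] /\
    [/\ is_adjoint HM Ti Ti, is_operator HM Ti, cancel T Ti & cancel Ti T].
Proof.
move=> SS C0 D0 SC SD; pose E := C + D; pose q := D / E.
have E0 : 0 < E by rewrite addr_gt0.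
have Ei0 : 0 <= E^-1 by rewrite invr_ge0 ltW.
have q0 : 0 <= q by rewrite divr_ge0 ?ltW.
have q1 : q < 1 by rewrite ltr_pdivrMr // mul1r /E; lra.
(* The bound [S <= D] gives [Q >= 0], and [S >= C] gives [Q <= 1 - C / E = q]. *)
pose Q y := y - hscale E^-1 (S y).
have QQ : is_adjoint HM Q Q.
  by move=> y z; rewrite ipBl ipBr ip_hscalel ip_hscaler SS.
have EC : E = C + D by [].
have Qb : forall y, N (Q y) <= q * N y.
  apply: operator_form_bound => // y; rewrite ipBl ip_hscalel.
    have -> : ip y y - E^-1%:c *: ip (S y) y =
        E^-1%:c *: (C%:c *: ip y y + (D%:c *: ip y y - ip (S y) y)).
      rewrite addrA scalerBr -scalerDl -real_complexD scalerA -real_complexM.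
      by rewrite mulVf ?gt_eqF // scale1r.
    apply: cs_posZ => //; apply: cs_posD; last exact: SD.
    exact: cs_posZ (ltW C0) (hm_ip_pos HM y).
  rewrite /cs_le.
  have -> : q%:c *: ip y y - (ip y y - E^-1%:c *: ip (S y) y) =
      E^-1%:c *: (ip (S y) y - C%:c *: ip y y).
    rewrite scalerBr scalerA -real_complexM.
    have -> : E^-1 * C = 1 - q by rewrite /q /E; field; rewrite gt_eqF ?addr_gt0.
    by rewrite real_complexD real_complexN scalerBl scale1r; zmod.
  exact: cs_posZ (SC y).
have [P [PP Pb PE]] := operator_sqrt QQ q0 (ltW q1) Qb.
(* A second root, of [1 - P], exhibits [T] as the square of the self-adjoint [U]; this is its
   positivity. *)
have [P2 [PP2 Pb2 PE2]] := operator_sqrt PP q0 (ltW q1) Pb.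
pose e := Num.sqrt E; pose f := Num.sqrt e.
have e0 : 0 < e by rewrite sqrtr_gt0.
have f0 : 0 < f by rewrite sqrtr_gt0.
have ee : e * e = E by rewrite -expr2 sqr_sqrtr // ltW.
have ff : f * f = e by rewrite -expr2 sqr_sqrtr // ltW.
have op r (B : H -> H) : 0 < r -> is_adjoint HM B B ->
    (forall y, N (B y) <= q * N y) -> is_operator HM (fun y => hscale r (y - B y)).
  move=> r0 BB Bb; apply: (adjoint_is_operator (K := r * (1 + q)) (adjoint_sub_scale r BB)).
  move=> y; rewrite hnorm_hscale ?(ltW r0) // -mulrA ler_pM2l //.
  rewrite (le_trans (gnormD (hnorm_gnorm HM) _ _)) // (gnormN (hnorm_gnorm HM)).
  by rewrite mulrDl mul1r lerD2l.
pose T y := hscale e (y - P y).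
have TT : is_adjoint HM T T := adjoint_sub_scale e PP.
have Tsurj z : exists y, T y = z.
  have PD := adjoint_additive PP.
  have [y Hy] := contraction_solve (hnorm_gnorm HM) (@hnorm_complete _ _ _ _ HM)
    PD Pb q0 q1 (hscale e^-1 z).
  by exists y; rewrite /T Hy hscaleM mulfV ?gt_eqF // hscale1.
(* From [|y - P y| >= (1 - q) |y|]; this yields both the injectivity of [T] and the bound on its
   inverse. *)
have Tlow y : N y <= (1 - q)^-1 / e * N (T y).
  rewrite hnorm_hscale ?(ltW e0) // mulrA mulfVK ?gt_eqF //.
  rewrite ler_pdivlMl ?subr_gt0 //.
  have := gnorm_sub_trans (hnorm_gnorm HM) (P y) y 0; rewrite !subr0.
  have := Pb y; lra.
have [Ti TiK] := choice Tsurj.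
have TK : cancel T Ti.
  move=> y; apply/eqP; rewrite -subr_eq0; apply/eqP/(gnorm_eq0 (hnorm_gnorm HM)).
  apply/eqP; rewrite eq_le hnorm_ge0 andbT (le_trans (Tlow _)) //.
  rewrite (additive_funB (adjoint_additive TT)) TiK subrr.
  by rewrite (gnorm0 (hnorm_gnorm HM)) mulr0.
have TiTi : is_adjoint HM Ti Ti.
  by move=> y z; rewrite -{1}[z]TiK -TT TiK.
exists T, Ti; split; split=> //.
- exact: op.
- pose U y := hscale f (y - P2 y).
  have UU : is_adjoint HM U U := adjoint_sub_scale f PP2.
  exists U, U; split=> //; first exact: op.
  move=> y; rewrite /U (adjoint_hscale _ _ PP2) -hscaleBr hscaleM ff.
  by rewrite PE2.
- move=> y; rewrite /T (adjoint_hscale _ _ PP) -hscaleBr hscaleM ee PE.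
  rewrite /Q opprB addrC subrK hscaleM mulfV ?gt_eqF // hscale1 //.
- apply: (adjoint_is_operator (K := (1 - q)^-1 / e) TiTi) => y.
  by rewrite (le_trans (Tlow _)) // TiK.
Qed.

End PositiveRoot.

(** * Frames *)

Section Frames.
Variables (R : realType) (A : algType R[i]) (CA : cstar A).
Variables (H : lmodType A) (HM : hilbert_module CA H) (J : option nat).
Local Notation star := (cs_star CA).
Local Notation nrm := (cs_norm CA).
Local Notation ip := (hm_ip HM).
Local Notation N := (hnorm HM).
Local Notation pos := (cs_pos CA).
Local Notation hscale := (@hscale R A H).
Local Notation "r %:c" := (Complex r 0) (at level 2, format "r %:c").

Lemma psumE (V : zmodType) (f : nat -> V) (n : nat) :
  psum J f n = \sum_(0 <= j < n | inJ J j) f j.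
Proof. by rewrite big_mkord. Qed.

Lemma psum_sub (V : zmodType) (f : nat -> V) (n m : nat) : (n <= m)%N ->
  psum J f m - psum J f n = \sum_(n <= j < m | inJ J j) f j.
Proof.
move=> nm; rewrite !psumE (big_cat_nat (n := n)) //=; zmod.
Qed.

Lemma psum_map (V W : zmodType) (F : V -> W) (f : nat -> V) (n : nat) :
  additive_fun F -> F (psum J f n) = psum J (fun j => F (f j)) n.
Proof. by move=> FD; apply: (big_morph F FD (additive_fun0 FD)). Qed.

Lemma ip_suml (I : Type) (r : seq I) (P : pred I) (F : I -> H) (z : H) :
  ip (\sum_(i <- r | P i) F i) z = \sum_(i <- r | P i) ip (F i) z.
Proof. by apply: (big_morph (fun x => ip x z)) => [x y|]; rewrite ?ipDl ?ip0l. Qed.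

(** The required positive expression is the sum of [(c a_i - b_i) (c a_i - b_i)^*]. *)
Lemma sum_cauchy_schwarz (I : Type) (r : seq I) (P : pred I) (a b : I -> A) :
  nrm (\sum_(i <- r | P i) a i * star (b i)) ^+ 2 <=
  nrm (\sum_(i <- r | P i) a i * star (a i)) *
  nrm (\sum_(i <- r | P i) b i * star (b i)).
Proof.
apply: cauchy_schwarz_abstract => [|c].
  by apply: cs_pos_sum => i _; apply: cs_pos_Mstar.
rewrite (big_morph star (starD CA) (star0 CA)).
rewrite !(mulr_sumr, mulr_suml) -!sumrB -big_split /=.
apply: cs_pos_sum => i _.
have := cs_pos_Mstar CA (c * a i - b i); congr (pos _).
rewrite starB !starM starK mulrBl !mulrBr !mulrA; zmod.
Qed.

(** * The synthesis operator of a Bessel sequence *)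

Section Synthesis.
Variables (x : nat -> H) (D : R).
Hypothesis D0 : 0 < D.
Hypothesis bessel : forall y, exists s,
  series_to CA J (fun j => ip y (x j) * ip (x j) y) s /\
  cs_le CA s (D%:c *: ip y y).

Lemma bessel_tail (y : H) (n m : nat) : (n <= m)%N ->
  nrm (\sum_(n <= j < m | inJ J j) ip y (x j) * star (ip y (x j))) <=
  D * N y ^+ 2.
Proof.
move=> nm; have [s [Hs sD]] := bessel y.
have E : \sum_(n <= j < m | inJ J j) ip y (x j) * star (ip y (x j)) =
         \sum_(n <= j < m | inJ J j) ip y (x j) * ip (x j) y.
  by apply: eq_bigr => j _; rewrite ip_star.
have p k l : pos (\sum_(k <= j < l | inJ J j) ip y (x j) * ip (x j) y).
  by apply: cs_pos_sum => j _; rewrite -(ip_star HM y) ; apply: cs_pos_Mstar.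
rewrite E hnorm_sq -nrmZ_ge0 ?(ltW D0) //; apply: cs_le_nrm => //.
apply: cs_le_trans sD; rewrite /cs_le.
set t := \sum_(n <= j < m | _) _.
apply: (cs_pos_closed (cvg_add (nrm_gnorm CA) (cvg_shift m Hs)
          (cvg_const (nrm_gnorm CA) (- t)))) => k.
set f := fun j => ip y (x j) * ip (x j) y.
(* What remains after removing the block from [n] to [m] is the block after [m] and the block before
   [n], both positive. *)
have -> : psum J f (m + k) - t =
    (psum J f (m + k) - psum J f m) + (psum J f n - psum J f 0).
  have -> : psum J f 0 = 0 by rewrite /psum big_ord0.
  by rewrite /t -psum_sub //; zmod.
by apply: cs_posD; rewrite psum_sub ?leq_addr.
Qed.

(** For [z] the block sum, [<z,z>] is the sum of [a_j <z,x_j>^*]. Cauchy-Schwarz and [bessel_tail]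
    at [z] bound [|z|^4] by a multiple of [|z|^2], which is cancelled. *)
Lemma synthesis_tail (a : nat -> A) (n m : nat) : (n <= m)%N ->
  N (\sum_(n <= j < m | inJ J j) a j *: x j) ^+ 2 <=
  D * nrm (\sum_(n <= j < m | inJ J j) a j * star (a j)).
Proof.
move=> nm; set z := \sum_(_ <= j < _ | _) _ *: _.
have := sum_cauchy_schwarz (index_iota n m) (inJ J) a (fun j => ip z (x j)).
have -> : \sum_(n <= j < m | inJ J j) a j * star (ip z (x j)) = ip z z.
  by rewrite {2}/z ip_suml; apply: eq_bigr => j _; rewrite ipZl ip_star.
set s := nrm (\sum_(n <= j < m | _) a j * _); have s0 : 0 <= s := nrm_ge0 CA _.
move=> /le_trans /(_ (ler_wpM2l s0 (bessel_tail z nm))).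
rewrite -hnorm_sq mulrA expr2.
have := sqr_ge0 (N z); rewrite le_eqVlt => /predU1P[<- _|z0].
  by rewrite mulr_ge0 // ltW.
by rewrite ler_pM2r // mulrC.
Qed.

Lemma synthesis_ex : exists th' : (nat -> A) -> H, forall a, in_l2 CA J a ->
  cvg_wrt N (psum J (fun j => a j *: x j)) (th' a).
Proof.
suff H1 a : exists l, in_l2 CA J a -> cvg_wrt N (psum J (fun j => a j *: x j)) l.
  by have [th Hth] := choice H1; exists th.
(* Outside [l_2] the value is the default [0], so that the choice gives a total function. *)
have [[s Hs]|] := pselect (in_l2 CA J a); last by exists 0.
suff /hnorm_complete[l Hl] : cauchy_wrt N (psum J (fun j => a j *: x j)) by exists l.
(* Two partial sums, each within [e^2 / (2 D)] of [s], differ by less than [e^2 / D];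
   [synthesis_tail] turns this into [e]. *)
move=> e e0; have eD : 0 < e ^+ 2 / D / 2 by rewrite !divr_gt0 ?exprn_gt0.
have [n0 Hn] := Hs _ eD.
have tail n m : (n0 <= n)%N -> (n <= m)%N ->
    N (psum J (fun j => a j *: x j) m - psum J (fun j => a j *: x j) n) < e.
  move=> n0n nm; rewrite psum_sub // -ltr_sqr ?nnegrE ?hnorm_ge0 ?(ltW e0) //.
  apply: le_lt_trans (synthesis_tail a nm) _.
  rewrite mulrC -ltr_pdivlMr // -psum_sub //.
  have := Hn _ n0n; have := Hn _ (leq_trans n0n nm).
  have := gnorm_sub_trans (nrm_gnorm CA) s (psum J (fun j => a j * star (a j)) m)
    (psum J (fun j => a j * star (a j)) n).
  rewrite (gnormBC (nrm_gnorm CA) s); lra.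
exists n0 => n m nn mm; have [nm|/ltnW mn] := leqP n m; last exact: tail.
by rewrite (gnormBC (hnorm_gnorm HM)); apply: tail.
Qed.

Lemma transform_in_l2 (y : H) : in_l2 CA J (frame_transform HM x y).
Proof.
have [s [Hs _]] := bessel y; exists s; apply: cvg_eq Hs => n.
by apply: eq_bigr => j _; rewrite /frame_transform ip_star.
Qed.

End Synthesis.
End Frames.

(** * The frame operator and its square root *)

Section FrameRoot.
Variables (R : realType) (A : algType R[i]) (CA : cstar A).
Variables (H : lmodType A) (HM : hilbert_module CA H) (J : option nat).
Local Notation star := (cs_star CA).
Local Notation nrm := (cs_norm CA).
Local Notation ip := (hm_ip HM).
Local Notation N := (hnorm HM).

Lemma frame_root (x : nat -> H) : standard_frame HM J x ->
  exists (th' : (nat -> A) -> H) (T Ti : H -> H),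
  [/\ is_transform_adjoint HM J x th',
      forall y, T (T y) = th' (frame_transform HM x y),
      forall y, cvg_wrt N (psum J (fun j => ip y (x j) *: x j)) (T (T y)) &
      forall y, series_to CA J (fun j => ip y (x j) * ip (x j) y) (ip (T (T y)) y)] /\
  [/\ is_adjoint HM T T, is_operator HM T & op_positive HM T] /\
  [/\ is_adjoint HM Ti Ti, is_operator HM Ti, cancel T Ti & cancel Ti T].
Proof.
move=> [C [D [C0 [D0 frame]]]].
have bessel y : exists s,
    series_to CA J (fun j => ip y (x j) * ip (x j) y) s /\
    cs_le CA s (Complex D 0 *: ip y y).
  by have [s [Hs [_ sD]]] := frame y; exists s.
have [th' Hth] := synthesis_ex D0 bessel.
pose S y := th' (frame_transform HM x y).
have Scvg y : cvg_wrt N (psum J (fun j => ip y (x j) *: x j)) (S y).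
  exact: (Hth _ (transform_in_l2 bessel y)).
have ip_psuml (f : nat -> H) z n : ip (psum J f n) z = psum J (fun j => ip (f j) z) n.
  exact: ip_suml.
have Sip y z : cvg_wrt nrm (psum J (fun j => ip y (x j) * ip (x j) z)) (ip (S y) z).
  apply: cvg_eq (cvg_ipl z (Scvg y)) => n; rewrite ip_psuml.
  by apply: eq_bigr => j _; rewrite ipZl.
(* Starring the partial sums for [<S z, y>] gives those for [<S y, z>] term by term. *)
have SS : is_adjoint HM S S.
  move=> y z; apply: (cvg_unique (nrm_gnorm CA) (Sip y z)).
  rewrite -ip_star; apply: cvg_eq (cvg_star (Sip z y)) => n.
  rewrite (psum_map J _ n (starD CA)); apply: eq_bigr => j _.
  by rewrite starM !ip_star.
have Sframe y : cs_le CA (Complex C 0 *: ip y y) (ip (S y) y) /\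
                cs_le CA (ip (S y) y) (Complex D 0 *: ip y y).
  by have [s [Hs]] := frame y; rewrite (cvg_unique (nrm_gnorm CA) (Sip y y) Hs).
have [T [Ti [[TT oT pT TS] [TiTi oTi TK TiK]]]] :=
  positive_operator_root SS C0 D0 (fun y => (Sframe y).1) (fun y => (Sframe y).2).
exists th', T, Ti; split; split=> //.
- move=> y a la; apply: cvg_eq (cvg_ipr y (Hth a la)) => n.
  rewrite -ip_star ip_psuml (psum_map J _ n (starD CA)); apply: eq_bigr => j _.
  by rewrite ip_star ipZr.
- by move=> y; rewrite TS.
- by move=> y; rewrite TS; apply: Sip.
Qed.

Lemma nt_frame_series (y : nat -> H) (z : H) : standard_nt_frame HM J y ->
  series_to CA J (fun j => ip z (y j) * ip (y j) z) (ip z z).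
Proof. by move=> /(_ z)[s [Hs [s1 s2]]]; rewrite (cs_le_antisym s1 s2). Qed.

(** Moving [T] across the inner product turns the frame sum at [z] into the tight one at [T' z],
    with value [<T' z, T' z>]. *)
Lemma nt_frame_image (y : nat -> H) (T : H -> H) :
  standard_nt_frame HM J y -> is_operator HM T -> op_invertible HM T ->
  standard_frame HM J (fun j => T (y j)).
Proof.
have pos_bound (B B' : H -> H) : is_adjoint HM B B' -> is_operator HM B ->
    exists2 K : R, 0 < K & forall x, N (B' x) <= K * N x.
  move=> BB [_ _ [K BK] _]; exists (`|K| + 1).
    by have := normr_ge0 K; lra.
  apply: (adjoint_bounded BB) => x; rewrite (le_trans (BK x)) //.
  by rewrite ler_wpM2r ?hnorm_ge0 //; have := ler_norm K; lra.
move=> nty oT [Ti [oTi TK TiK]].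
have [_ _ _ [T' TT]] := oT; have [_ _ _ [Ti' TTi]] := oTi.
have [K K0 TK'] := pos_bound _ _ TT oT; have [L L0 TL'] := pos_bound _ _ TTi oTi.
have Ti'T' z : Ti' (T' z) = z.
  by apply: (ip_ext (HM := HM)) => w; rewrite (adjoint_sym TTi) (adjoint_sym TT) TiK.
have L2 : 0 < L ^+ 2 by rewrite exprn_gt0.
exists (L ^- 2), (K ^+ 2); split; first by rewrite invr_gt0.
split; first by rewrite exprn_gt0.
move=> z; exists (ip (T' z) (T' z)); split.
  apply: cvg_eq (nt_frame_series (T' z) nty) => n; apply: eq_bigr => j _.
  by rewrite (adjoint_sym TT) TT.
split; last exact: operator_le (adjoint_sym TT) K0 TK' z.
(* The lower bound comes from the adjoint of the inverse: [z = Ti' (T' z)] gives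
   [<z,z> <= L^2 <T' z, T' z>]. *)
have := operator_le (adjoint_sym TTi) L0 TL' (T' z); rewrite Ti'T' /cs_le.
have Li : 0 <= L ^- 2 by rewrite invr_ge0 ltW.
move=> /(cs_posZ Li); congr (cs_pos CA).
rewrite scalerBr scalerA -real_complexM mulVf ?gt_eqF // scale1r //.
Qed.

Lemma frame_spans_dense (x : nat -> H) :
  standard_frame HM J x -> spans_dense HM J x.
Proof.
move=> /frame_root[th' [T [Ti [[_ _ Tcvg _] [_ [_ _ _ TiK]]]]]] y e e0.
(* Since [Ti (Ti y)] is [S^-1 y], the partial sums of its frame expansion converge to [y]. *)
have [n Hn] := Tcvg (Ti (Ti y)) e e0.
exists n, (fun j => ip (Ti (Ti y)) (x j)).
by have := Hn n (leqnn n); rewrite !TiK (gnormBC (hnorm_gnorm HM)).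
Qed.

End FrameRoot.

Theorem theorem5p3 (R : realType) (A : algType R[i]) (CA : cstar A)
    (H : lmodType A) (HM : hilbert_module CA H) (J : option nat) :
  countably_generated HM ->
  (* direct part: x_j = T y_j with T = (theta^* theta)^{1/2} positive invertible *)
  (forall x : nat -> H, standard_frame HM J x ->
     exists th' : (nat -> A) -> H,
       is_transform_adjoint HM J x th' /\
       exists T : H -> H,
         [/\ is_operator HM T, op_invertible HM T, op_positive HM T,
             (forall y : H, T (T y) = th' (frame_transform HM x y)) &
             exists y : nat -> H,
               standard_nt_frame HM J y /\
               (forall j : nat, inJ J j -> x j = T (y j))]) /\
  (* converse *)
  (forall (y : nat -> H) (T : H -> H),
     standard_nt_frame HM J y -> is_operator HM T -> op_invertible HM T ->
     standard_frame HM J (fun j => T (y j))) /\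
  (* standard frames generate H *)
  (forall x : nat -> H, standard_frame HM J x -> spans_dense HM J x).
Proof.
move=> _; split; last by split; [exact: nt_frame_image | exact: frame_spans_dense].
move=> x /frame_root[th' [T [Ti [[adj Tth _ Tser] [[TT oT pT] [TiTi oTi TK TiK]]]]]].
exists th'; split=> //; exists T; split=> //; first by exists Ti.
exists (fun j => Ti (x j)); split=> [y|j _]; last by rewrite TiK.
exists (hm_ip HM y y); split; last by split; rewrite /cs_le subrr; apply: cs_pos0.
(* The frame sum of [x] at [Ti y] is [<T y, Ti y> = <y,y>]; self-adjointness of [Ti] moves it onto
   each [x j]. *)
have := Tser (Ti y); rewrite TiK TT TiK.
by apply: cvg_eq => n; apply: eq_bigr => j _; rewrite (TiTi y) (TiTi (x j)).
Qed.
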